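(* Let $3\le m\le\infty$, let $k\ge2$ be an integer and let $E_0:\mathbb S^1\to\mathbb S^1$ be fixed and linear, $E_0(x)=kx\bmod1$. Let $\mathscr V_{(m)}\subset C^m(\mathbb S^1)$ be the subset consisting of those real valued $\tau_0\in C^m(\mathbb S^1)$ for which the skew product $$f_0(x,s)=\Big(E_0(x),\ s+\tfrac1{2\pi}\tau_0(x)\bmod1\Big)$$ on $\mathbb T^2$ is not partially captive. Then $\mathscr V_{(m)}$ is a meager set with empty interior in $C^m(\mathbb S^1)$.
   Context: $\mathbb S^1=\mathbb R/\mathbb Z$, $\mathbb T^2=\mathbb S^1\times\mathbb S^1$; $C^m(\mathbb S^1)$ here consists of real valued functions with its usual $C^m$ topology (Fréchet topology if $m=\infty$). Partial captivity of $f_0$. Let $\lambda_0=\min_xE_0'(x)=k$, $\lambda=(\lambda_0+1)/2$, fix $\kappa\in(1,\lambda)$ (e.g. $\kappa=(\lambda+1)/2$), $C_\tau=\max_x|\tau_0'(x)|+1$, $R_\kappa\ge C_\tau/(\lambda-\kappa)$ (depending on $\tau_0$), and $\mathcal Z=\mathbb S^1\times[-R_\kappa,R_\kappa]\subset T^*\mathbb S^1$. For $0\le j\le k-1$ and $(y,\eta)\in T^*\mathbb S^1=\mathbb S^1\times\mathbb R$ (with $y$ represented in $[0,1)$) let $F_j(y,\eta)=(x_j,\,k\eta+\tau_0'(x_j))$, $x_j=(y+j)/k$. Let $\mathcal N(0;n)=\max_{(y,\eta)\in\mathcal Z}\#\{\alpha\in\{0,\dots,k-1\}^n:\ F_{\alpha_n}\circ\cdots\circ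 F_{\alpha_1}(y,\eta)\in\mathcal Z\}$. $f_0$ is partially captive if $\lim_{n\to\infty}\frac1n\log\mathcal N(0;n)=0$ (this does not depend on the choice of $\mathcal Z$). *)

(* Defs.v *)
From HB Require Import structures.
From mathcomp Require Import all_boot all_order all_algebra.
From mathcomp Require Import all_classical all_reals all_analysis.
Set Implicit Arguments.
Unset Strict Implicit.
Unset Printing Implicit Defensive.
Import Order.TTheory GRing.Theory Num.Theory.
Import numFieldNormedType.Exports.
Local Open Scope ring_scope.
Local Open Scope classical_set_scope.

Definition nowhere_dense (T : topologicalType) (A : set T) : Prop :=
  interior (closure A) = set0.

Definition meager (T : topologicalType) (A : set T) : Prop :=
  exists2 B : nat -> set T,
    (forall i, nowhere_dense (B i)) & A = \bigcup_i B i.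

(* Orders of differentiability: [Some r] is the finite order r, [None] is
   infinity. *)
Definition le_order (j : nat) (m : option nat) : bool :=
  if m is Some r then (j <= r)%N else true.

(* Functions on the circle R/Z are represented by 1-periodic functions on R. *)
Definition is_Cm_circle (R : realType) (m : option nat) (f : R -> R) : Prop :=
  [/\ periodic f 1,
      forall j, le_order j.+1 m -> forall x, derivable (f^`(j)) x 1
    & forall j, le_order j m -> continuous (f^`(j))].

Record Cm_circle (R : realType) (m : option nat) := MkCmCircle {
  Cm_fun :> R -> R;
  Cm_funP : is_Cm_circle m Cm_fun }.

HB.instance Definition _ (R : realType) (m : option nat) :=
  gen_eqMixin (Cm_circle R m).
HB.instance Definition _ (R : realType) (m : option nat) :=
  gen_choiceMixin (Cm_circle R m).

(* The entries of order j > m are set to 0, hence carry no information. *)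
Definition Cm_jet (R : realType) (m : option nat) (f : Cm_circle R m) :
    prod_topology (fun _ : nat => {uniform R -> R}) :=
  fun j => if le_order j m then f^`(j) else cst 0.

(* The C^m topology (the Frechet topology when m is infinite): the coarsest one
   for which f |-> f^`(j) is continuous into the space of functions with
   uniform convergence, for all finite j <= m. *)
HB.instance Definition _ (R : realType) (m : option nat) :=
  Topological.copy (Cm_circle R m) (initial_topology (@Cm_jet R m)).

(* The skew product under study is
     f_0 (x, s) = (k x mod 1, s + tau x / (2 pi) mod 1);
   its partial captivity depends on the data k and tau only. *)

(* lambda_0 = min E_0' with E_0 (x) = k x mod 1. *)
Definition lambda0 (R : realType) (k : nat) : R := k%:R.

Definition lambda (R : realType) (k : nat) : R := (lambda0 R k + 1) / 2.

(* The supremum is a maximum when tau is C^1 and periodic. *)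
Definition C_tau (R : realType) (tau : R -> R) : R :=
  sup (range (fun x => `|derive1 tau x|)) + 1.

(* The points of the circle are represented in [0, 1[. *)
Definition trapping_zone (R : realType) (r : R) : set (R * R) :=
  [set p | (0 <= p.1 < 1) /\ (- r <= p.2 <= r)].

Definition cotangent_branch (R : realType) (k : nat) (tau : R -> R)
    (p : R * R) (j : 'I_k) : R * R :=
  let x := (p.1 + j%:R) / k%:R in (x, k%:R * p.2 + derive1 tau x).

(* [foldl] applies the first letter of the word first. *)
Definition cotangent_word (R : realType) (k : nat) (tau : R -> R) (n : nat)
    (a : n.-tuple 'I_k) (p : R * R) : R * R :=
  foldl (@cotangent_branch R k tau) p a.

Definition trapped_words (R : realType) (k : nat) (tau : R -> R) (r : R)
    (n : nat) (p : R * R) : {set n.-tuple 'I_k} :=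
  [set a | cotangent_word tau a p \in trapping_zone r]%SET.

(* The maximum of #|trapped_words k tau r n p| over p in the zone, written as
   the largest of the attained values c; these are all at most
   #|{: n.-tuple 'I_k}| = k ^ n. *)
Definition trapped_max (R : realType) (k : nat) (tau : R -> R) (r : R)
    (n : nat) : nat :=
  \max_(c < (k ^ n).+1 |
      `[< exists2 p, trapping_zone r p & #|trapped_words k tau r n p| = c >]) c.

Definition partially_captive (R : realType) (k : nat) (tau : R -> R) (r : R) :
    Prop :=
  (fun n : nat => n%:R^-1 * ln (trapped_max k tau r n)%:R : R) @ \oo --> (0 : R).

(* The zone is the product of the circle and [- rho tau, rho tau]. *)
Definition not_captive (R : realType) (m : option nat) (k : nat)
    (rho : Cm_circle R m -> R) : set (Cm_circle R m) :=
  [set tau : Cm_circle R m | ~ partially_captive k tau (rho tau)].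

(* Main.v *)
Require Import Defs.
From mathcomp Require Import all_boot all_order all_algebra.
From mathcomp Require Import all_classical all_reals all_analysis.
From mathcomp Require Import ring lra zify.
Import Order.TTheory GRing.Theory Num.Theory.
Import numFieldNormedType.Exports.
Set Implicit Arguments.
Unset Strict Implicit.
Unset Printing Implicit Defensive.
Local Open Scope ring_scope.
Local Open Scope classical_set_scope.

(** Along a word [a] of length [n] the momentum evolves as
    [k ^ n * eta + momentum tau' y a], where [momentum tau' y a] is the sum of
    [k ^ (n - i) * tau' (x_i)] over the points [x_i] of the backward orbit of
    [y] along [a]. Hence, up to a constant factor, the maximal number of
    trapped words is the largest number of words of length [n] whose momenta lie within [rho]
    of one real number. This is [multiplicity k tau' rho n]. It is
    submultiplicative in [n], because a momentum which leaves the zone never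
    comes back ([multiplicityD]). So partial captivity means that for every
    [eps > 0] some [n] satisfies [multiplicity n <= exp (eps * n)]
    ([partially_captiveP]). With some room in [rho], this condition for a fixed
    [eps] is open in the C^1 topology ([eps_captive_open]). Once it is shown to
    be dense in the C^m topology, the complement of each of these countably many
    open sets is closed and nowhere dense, and Baire's argument in the complete
    space C^m ([Cm_limit]) gives the theorem.

    Density ([eps_captive_dense]) is proved by a moment method inside a finite
    dimensional family [tau + sum_l t_l * Phi_l], where [Phi_l'] is, up to a
    constant, a trigonometric bump concentrated near [l / L]. Two words of equal
    length see the same multiple of a constant, so only the bumps matter for
    differences of momenta. Let the parameters run over a finite grid of [T]
    points per coordinate, and assume that at every parameter all
    multiplicities exceed [gamma ^ (2 n)].

    - Comparing with the trivial bound [k ^ n], there is a length at which the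
      multiplicity grows by a factor [gamma ^ d] over [d] further steps
      ([growth_step]). At the longer length [m] take a maximal set [B] of words
      with nearly equal momenta. A prefix of length [d] is shared by at most
      [#|B| / gamma ^ d] of them, since the words with a given prefix are
      words of length [m - d] trapped at the endpoint of that prefix.
    - Preimages of [y] of order [d] are [k ^ - d]-separated, so for a given word
      [b] few words [a] in [B] reach at time [d] a point close to one of the
      first [D] points of the orbit of [b]. Therefore at least half of the
      [p + 1]-tuples of words in [B] are nonrecurrent: no word of the tuple
      approaches in this sense the orbit of another ([many_nonrecurrent]).
    - For a nonrecurrent tuple each word has a bump of its own, which acts on
      that word at time [d] and on the other words only after time [D]. The
      dependence of the [p] differences of momenta on [p] parameters is thus
      diagonally dominant, uniformly in [m] ([transversality]), and a fixed
      tuple has coherent momenta for a proportion [O (k ^ (- p * m))] of the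
      parameters only ([card_coherent_params]).
    - There are [k ^ m] base points to consider and [k ^ (m * (p + 1))] tuples,
      so on average over the parameters [O (k ^ (2 m))] of them are coherent
      ([coherent_tuples_le]), whereas each parameter has at least
      [gamma ^ (2 m (p + 1)) / 2] of them. For [p] large this is impossible. *)

(** * Exponential growth *)

Lemma expr_dominates (R : realType) (gamma a b : R) : 1 < gamma -> 0 <= a -> 0 <= b ->
  exists2 d, (0 < d)%N & a * d%:R + b <= gamma ^+ d.
Proof.
move=> g1 a0 b0; set h := gamma - 1; have h0 : 0 < h by rewrite subr_gt0.
have bern n : n%:R * h <= gamma ^+ n.
  elim: n => [|n IH]; first by rewrite mul0r.
  have p1 : 1 <= gamma ^+ n by rewrite exprn_ege1// ltW.
  have : h * 1 <= h * gamma ^+ n by rewrite ler_wpM2l// ltW.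
  have -> : gamma ^+ n.+1 = gamma ^+ n + h * gamma ^+ n by rewrite exprS /h; ring.
  by rewrite -natr1; lra.
pose N := Num.truncn ((2 * a + b) / h ^+ 2).
have hN : (2 * a + b) <= N.+1%:R * h ^+ 2.
  by rewrite -ler_pdivrMr ?exprn_gt0//; exact/ltW/truncnS_gt.
exists (2 * N.+1)%N => //; rewrite mulnC exprM.
set n : R := N.+1%:R in hN *.
have n1 : 1 <= n by rewrite ler1n.
apply: (@le_trans _ _ ((n * h) ^+ 2)); last first.
  by rewrite lerXn2r ?nnegrE ?mulr_ge0 ?exprn_ge0 ?(ltW h0) ?bern// ltW// (lt_trans _ g1).
rewrite natrM -/n exprMn.
have : b <= b * n by rewrite ler_peMr.
have : n * (2 * a + b) <= n * (n * h ^+ 2) by rewrite ler_wpM2l//; lra.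
by rewrite [n ^+ 2]expr2; lra.
Qed.

Lemma expr_unbounded (R : realType) (c A : R) : 1 < c -> exists n : nat, A <= c ^+ n.
Proof.
move=> c1; have [n _ hn] := expr_dominates c1 (lexx 0) (normr_ge0 A).
by exists n; apply: le_trans hn; rewrite mul0r add0r ler_norm.
Qed.

(** * Backward orbits and momenta *)

Section Words.
Variable k : nat.
Hypothesis hk : (2 <= k)%N.
Implicit Types a b : seq 'I_k.

(** The value of [a] in base [k], the first letter having weight 1: these values
    number the [k ^ n] preimages of order [n] of a point. *)
Definition word_index a : nat := foldr (fun (j : 'I_k) c => (j + k * c)%N) 0%N a.

Lemma word_index_lt a : (word_index a < k ^ size a)%N.
Proof. by elim: a => //= j a IH; rewrite expnS; have := ltn_ord j; nia. Qed.

Lemma word_index_inj a b : size a = size b -> word_index a = word_index b -> a = b.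
Proof.
elim: a b => [|i a IH] [|j b] //= [sab] cab.
have ij : i = j :> nat.
  have := congr1 (modn^~ k) cab.
  by rewrite ![(k * _)%N]mulnC ![(_ + _ * k)%N]addnC !modnMDl !modn_small.
congr (_ :: _); first exact: val_inj.
by apply: IH => //; move: cab; rewrite ij => /addnI /eqP; rewrite eqn_pmul2l ?(eqP _) => [/eqP //|]; lia.
Qed.

End Words.

Section BackwardOrbits.
Variables (R : realType) (k : nat).
Hypothesis hk : (2 <= k)%N.
Implicit Types (g h : R -> R) (y z : R) (a b : seq 'I_k).

Let k0 : (0 : R) < k%:R. Proof. by rewrite ltr0n; lia. Qed.
Let kn0 : k%:R != 0 :> R. Proof. by rewrite gt_eqF. Qed.
Let k2 : (2 : R) <= k%:R. Proof. by rewrite (ler_nat R 2 k). Qed.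

Definition endpoint y a : R := foldl (fun x (j : 'I_k) => (x + j%:R) / k%:R) y a.

Lemma endpointE y a : endpoint y a = (y + (word_index a)%:R) / k%:R ^+ size a.
Proof.
elim: a y => [|j a IH] y /=; first by rewrite expr0 divr1 addr0.
by rewrite IH natrD natrM exprS; field; rewrite kn0 expf_neq0.
Qed.

Lemma endpoint_range y a : 0 <= y < 1 -> 0 <= endpoint y a < 1.
Proof.
move=> /andP[y0 y1]; rewrite endpointE.
have K0 : 0 < k%:R ^+ size a :> R by rewrite exprn_gt0.
rewrite divr_ge0 ?addr_ge0 ?ler0n ?(ltW K0)//= ltr_pdivrMr// mul1r.
apply: (@lt_le_trans _ _ ((word_index a).+1%:R)); first by rewrite -natr1; lra.
by rewrite -natrX ler_nat word_index_lt.
Qed.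

(** The second component of the composed inverse branches of the cotangent map,
    minus the contribution [k ^ size a * eta] of the initial momentum. *)
Definition momentum g y a : R :=
  \sum_(i < size a) k%:R ^+ (size a - i.+1) * g (endpoint y (take i.+1 a)).

Lemma momentum_nil g y : momentum g y [::] = 0.
Proof. by rewrite /momentum big_ord0. Qed.

Lemma momentum_cons g y j a : momentum g y (j :: a) =
  k%:R ^+ size a * g ((y + j%:R) / k%:R) + momentum g ((y + j%:R) / k%:R) a.
Proof.
rewrite /momentum /= big_ord_recl /= take0 subn1 /=; congr (_ + _).
Qed.

(** The cocycle relation behind everything that concerns prefixes. *)
Lemma momentum_cat g y a b :
  momentum g y (a ++ b) =
  k%:R ^+ size b * momentum g y a + momentum g (endpoint y a) b.
Proof.
elim: a y => [|j a IH] y /=; first by rewrite momentum_nil mulr0 add0r.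
rewrite !momentum_cons IH size_cat mulrDr addrA mulrA -exprD addnC.
by congr (_ + _).
Qed.

Lemma cotangent_wordE g y eta (tau : R -> R) a : (forall x, g x = derive1 tau x) ->
  foldl (@cotangent_branch R k tau) (y, eta) a =
  (endpoint y a, k%:R ^+ size a * eta + momentum g y a).
Proof.
move=> gE; elim: a y eta => [|j a IH] y eta /=.
  by rewrite momentum_nil expr0 mul1r addr0.
rewrite /cotangent_branch IH /= momentum_cons -gE exprS; congr (_, _); ring.
Qed.

Lemma momentum_sum (I : finType) (h : I -> R -> R) (t : I -> R) g y a :
  momentum (fun x => g x + \sum_i t i * h i x) y a =
  momentum g y a + \sum_i t i * momentum (h i) y a.
Proof.
rewrite /momentum.
under [X in _ = _ + X]eq_bigr do rewrite mulr_sumr.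
rewrite exchange_big /= -big_split /=; apply: eq_bigr => i _.
by rewrite mulrDr mulr_sumr; congr (_ + _); apply: eq_bigr => j _; ring.
Qed.

Lemma momentum_diff g h y a (C : R) :
  (forall x, `|g x - h x| <= C) ->
  `|momentum g y a - momentum h y a| <= k%:R ^+ size a * C.
Proof.
move=> gh; have C0 : 0 <= C by apply: le_trans (gh 0).
elim: a y => [|j a IH] y; first by rewrite !momentum_nil subrr normr0 expr0 mul1r.
rewrite !momentum_cons /= exprS.
set u := _ / _; have := IH u; have := gh u.
have K0 : 0 < k%:R ^+ size a :> R by rewrite exprn_gt0.
set K := k%:R ^+ size a in K0 *.
rewrite !ler_norml => /andP[A1 A2] /andP[B1 B2].
have K1 : K * 2 * C <= k%:R * K * C.
  by rewrite ler_wpM2r// mulrC ler_wpM2r// ltW.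
have := ler_wpM2l (ltW K0) A1; have := ler_wpM2l (ltW K0) A2.
by move=> ? ?; apply/andP; split; lra.
Qed.

(** Each step multiplies momenta by [k] but contracts the base by [k], so base
    points at distance [k ^ - n] have momenta at bounded distance after [n]
    steps. This allows the base point to be taken on a finite grid. *)
Lemma momentum_lip g Lip y y' a : 0 <= Lip ->
  (forall u v, `|g u - g v| <= Lip * `|u - v|) ->
  `|momentum g y a - momentum g y' a| <= k%:R ^+ size a * Lip * `|y - y'|.
Proof.
move=> L0 gL; elim: a y y' => [|j a IH] y y'.
  by rewrite !momentum_nil subrr normr0 expr0 mul1r mulr_ge0.
rewrite !momentum_cons /= exprS.
set u := (y + _) / _; set v := (y' + _) / _.
have uv : `|u - v| <= `|y - y'| / 2.
  have -> : u - v = (y - y') / k%:R by rewrite /u /v; field.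
  rewrite normrM ler_wpM2l// ger0_norm ?invr_ge0 ?(ltW k0)//.
  by rewrite lef_pV2 ?posrE.
have := IH u v; have := gL u v.
have K0 : 0 < k%:R ^+ size a :> R by rewrite exprn_gt0.
set K := k%:R ^+ size a in K0 *.
move=> A B; have A' : `|g u - g v| <= Lip * (`|y - y'| / 2).
  by apply: le_trans A _; rewrite ler_wpM2l.
have B' : `|momentum g u a - momentum g v a| <= K * (Lip * (`|y - y'| / 2)).
  by apply: le_trans B _; rewrite -mulrA ler_wpM2l ?(ltW K0)// ler_wpM2l.
have K1 : K * (Lip * `|y - y'|) <= k%:R * K * Lip * `|y - y'|.
  have -> : k%:R * K * Lip * `|y - y'| = k%:R * (K * (Lip * `|y - y'|)) by ring.
  by rewrite ler_peMl ?mulr_ge0 ?(ltW K0)//; apply: le_trans k2; lra.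
move: A' B'; rewrite !ler_norml => /andP[A1 A2] /andP[B1 B2].
have := ler_wpM2l (ltW K0) A1; have := ler_wpM2l (ltW K0) A2.
by move=> ? ?; apply/andP; split; lra.
Qed.

Lemma momentum_ge0 g y a : (forall x, 0 <= g x) -> 0 <= momentum g y a.
Proof. by move=> g0; apply: sumr_ge0 => i _; rewrite mulr_ge0// exprn_ge0// ltW. Qed.

Lemma momentum_ge g y a d : (forall x, 0 <= g x) -> (0 < d <= size a)%N ->
  k%:R ^+ (size a - d) * g (endpoint y (take d a)) <= momentum g y a.
Proof.
move=> g0 /andP[d0 da]; case: d d0 da => // d _ da.
rewrite /momentum (bigD1 (Ordinal da))//= lerDl.
by apply: sumr_ge0 => i _; rewrite mulr_ge0// exprn_ge0// ltW.
Qed.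

(** Later points of the orbit have geometrically smaller weights: beyond time [D]
    all of them together weigh at most [k ^ - D] relative to [k ^ n]. *)
Lemma momentum_le g y a (c : R) D : 0 <= c ->
  (forall x, 0 <= g x <= 1) -> (D <= size a)%N ->
  (forall i, (0 < i <= D)%N -> g (endpoint y (take i a)) <= c) ->
  momentum g y a <= k%:R ^+ size a * c + k%:R ^+ (size a - D).
Proof.
move=> c0 g01; elim: a y D => [|j a IH] y D /= Da gc.
  by rewrite momentum_nil addr_ge0 ?mulr_ge0 ?exprn_ge0// ltW.
rewrite momentum_cons; set u := (y + _) / _.
have K0 : 0 < k%:R ^+ size a :> R by rewrite exprn_gt0.
have K1 (C : R) : 0 <= C -> 2 * (k%:R ^+ size a * C) <= k%:R ^+ (size a).+1 * C.
  by move=> C0; rewrite mulrA ler_wpM2r// exprS ler_wpM2r// ltW.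
case: D => [|D] in Da gc *.
  have h : momentum g u a <= k%:R ^+ size a.
    have := momentum_diff u a (g := g) (h := fun=> 0) (C := 1).
    have -> : momentum (fun=> 0) u a = 0.
      by rewrite /momentum big1// => i _; rewrite mulr0.
    rewrite subr0 mulr1 => hh; apply: le_trans (ler_norm _) (hh _) => x.
    by rewrite subr0 ger0_norm; case/andP: (g01 x).
  have /andP[g0 g1] := g01 u.
  have := ler_wpM2l (ltW K0) g1; have := K1 1 ler01; have := K1 c c0.
  have := mulr_ge0 (ltW K0) c0.
  rewrite subn0; lra.
have h' : forall i : nat, (0 < i <= D)%N -> (0 < i.+1 <= D.+1)%N.
  by move=> i /andP[_]; rewrite ltnS.
have h := IH u D Da (fun i hi => gc i.+1 (h' i hi)).
rewrite subSS.
have := gc 1%N isT; rewrite /= take0 /= -/u => g1.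
have := ler_wpM2l (ltW K0) g1; have := K1 c c0; lra.
Qed.

End BackwardOrbits.

(** * Words trapped at a point *)

(** Fix [b], the value of the tuple at [j']. Then at most [nu] values remain for
    the coordinate [j] and [#|B|] for each of the other [q - 2] coordinates. *)
Lemma card_ffun_pair (W : finType) (B : {set W}) (r : rel W) (nu q : nat)
    (j j' : 'I_q) :
  j != j' -> (forall b, b \in B -> #|[set a in B | r a b]%SET| <= nu)%N ->
  (#|[set f : {ffun 'I_q -> W} | [forall i, f i \in B] && r (f j) (f j')]%SET|
     * #|B| <= nu * #|B| ^ q)%N.
Proof.
move=> jj' hnu.
set S := [set f : {ffun 'I_q -> W} | _]%SET.
pose F b i : {pred W} := if i == j' then pred1 b else
  if i == j then mem [set a in B | r a b]%SET else mem B.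
have cardF b : b \in B -> (#|family (F b)| * #|B| * #|B| <= nu * #|B| ^ q)%N.
  move=> bB; have E : (#|B| ^ q =
      #|B| * (#|B| * \prod_(i < q | (i != j') && (i != j)) #|B|))%N.
    rewrite -[X in (_ ^ X)%N]card_ord -prod_nat_const.
    by rewrite (bigD1 j')//= (bigD1 j).
  rewrite card_family -[foldr _ _ _]/(foldr muln 1%N _).
  have -> : foldr muln 1%N [seq #|F b x| | x : 'I_q] = (\prod_(i < q) #|F b i|)%N.
    by rewrite /image_mem foldrE big_map big_enum.
  rewrite (bigD1 j')//= (bigD1 j)//= {1}/F eqxx card1 mul1n.
  rewrite {1}/F (negbTE jj') eqxx.
  rewrite (eq_bigr (fun=> #|B|)); last first.
    by move=> i /andP[i1 i2]; rewrite /F (negbTE i1) (negbTE i2).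
  rewrite E; set u := #|_|; set Q := (\prod_(i | _) _)%N.
  have -> : (u * Q * #|B| * #|B| = u * (#|B| * (#|B| * Q)))%N by lia.
  by rewrite leq_mul2r hnu ?orbT.
have : (#|S| <= \sum_(b in B) #|family (F b)|)%N.
  rewrite -sum1_card (partition_big (fun f : {ffun _} => f j') (mem B)) /=; last first.
    by move=> f; rewrite inE => /andP[/forallP/(_ j')].
  apply: leq_sum => b bB; rewrite sum1_card; apply: subset_leq_card.
  apply/fintype.subsetP => f; rewrite unfold_in /= inE => /andP[/andP[/forallP fB rf] /eqP fb].
  apply/familyP => i; rewrite /F; case: eqP => [->|_]; first by rewrite inE fb.
  by case: eqP => [->|_]; rewrite ?inE ?fB//= -fb.
have [/eqP B0|B0] := posnP #|B|.
  by rewrite (eqP B0) muln0.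
move=> le1; rewrite -(leq_pmul2r B0).
apply: leq_trans (leq_mul (leq_mul le1 (leqnn _)) (leqnn _)) _.
rewrite -mulnA big_distrl /=.
apply: (@leq_trans (\sum_(b in B) (nu * #|B| ^ q))).
  by apply: leq_sum => b bB; rewrite mulnA cardF.
by rewrite sum_nat_const mulnC.
Qed.

Section Trapping.
Variables (R : realType) (k : nat).
Hypothesis hk : (2 <= k)%N.
Implicit Types (g h : R -> R) (y z rho zeta : R) (n : nat).

Let k0 : (0 : R) < k%:R. Proof. by rewrite ltr0n; lia. Qed.
Let kn0 : k%:R != 0 :> R. Proof. by rewrite gt_eqF. Qed.
Let k2 : (2 : R) <= k%:R. Proof. by rewrite (ler_nat R 2 k). Qed.

Definition trap g rho n y zeta : {set n.-tuple 'I_k} :=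
  [set a : n.-tuple 'I_k | `|momentum g y a - zeta| <= rho]%SET.

(** The centre [zeta] ranges over the whole line and not over a bounded zone.
    This makes the quantity insensitive to adding a constant to [g]. *)
Definition multiplicity g rho n : nat :=
  \max_(c < (k ^ n).+1 | `[< exists y zeta, 0 <= y < 1 /\
      #|trap g rho n y zeta| = c >]) c.

Lemma trap_le g rho n y zeta : 0 <= y < 1 ->
  (#|trap g rho n y zeta| <= multiplicity g rho n)%N.
Proof.
move=> y01.
have lt : (#|trap g rho n y zeta| < (k ^ n).+1)%N.
  by rewrite ltnS; apply: leq_trans (max_card _) _; rewrite card_tuple card_ord.
rewrite /multiplicity -[X in (X <= _)%N]/(nat_of_ord (Ordinal lt)).
apply: (@leq_bigmax_cond _ _ (fun c => nat_of_ord c)).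
by apply/asboolP; exists y, zeta.
Qed.

Lemma multiplicity_le g rho n : (multiplicity g rho n <= k ^ n)%N.
Proof. by apply/bigmax_leqP => c _; rewrite -ltnS. Qed.

Lemma multiplicity_attained g rho n : exists y zeta,
  0 <= y < 1 /\ #|trap g rho n y zeta| = multiplicity g rho n.
Proof.
have lt : (#|trap g rho n 0 0| < (k ^ n).+1)%N.
  by rewrite ltnS; apply: leq_trans (max_card _) _; rewrite card_tuple card_ord.
pose P : pred 'I_(k ^ n).+1 := fun c => `[< exists y zeta, 0 <= y < 1 /\
      #|trap g rho n y zeta| = c >].
have P0 : (0 < #|P|)%N.
  by apply/card_gt0P; exists (Ordinal lt); apply/asboolP; exists 0, 0; rewrite lexx ltr01.
have [c /asboolP[y [zeta [y01 yc]]] E] := eq_bigmax_cond (fun c : 'I_(k ^ n).+1 => nat_of_ord c) P0.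
by exists y, zeta; split=> //; rewrite yc -E.
Qed.

Lemma uniq_le_multiplicity g rho n y zeta (s : seq (seq 'I_k)) : 0 <= y < 1 ->
  uniq s -> {in s, forall a, size a = n /\ `|momentum g y a - zeta| <= rho} ->
  (size s <= multiplicity g rho n)%N.
Proof.
move=> y01 us hs; apply: leq_trans (trap_le g rho n zeta y01).
rewrite cardE -(size_map val) uniq_leq_size// => a /hs[sa ta].
apply/mapP; exists (Tuple (introT eqP sa)) => //.
by rewrite mem_enum inE.
Qed.

(** By the cocycle relation, words with the common prefix [w] are trapped if and
    only if their remainders are trapped at the endpoint of [w], around another
    centre. *)
Lemma card_prefix_class g rho d n y zeta (w : seq 'I_k) : 0 <= y < 1 ->
  size w = d ->
  (#|[set a in trap g rho (d + n) y zeta | take d a == w]%SET|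
     <= multiplicity g rho n)%N.
Proof.
move=> y01 sw; set A := [set a in _ | _]%SET.
have inA (a : (d + n).-tuple 'I_k) : a \in A -> val a = w ++ drop d a.
  by rewrite inE => /andP[_ /eqP <-]; rewrite cat_take_drop.
rewrite cardE -(size_map (fun a : (d + n).-tuple 'I_k => drop d a)).
apply: (@uniq_le_multiplicity g rho n (endpoint y w)
          (zeta - k%:R ^+ n * momentum g y w)).
- exact: endpoint_range.
- rewrite map_inj_in_uniq ?enum_uniq// => a b; rewrite !mem_enum => aA bA ab.
  by apply: val_inj; rewrite /= (inA _ aA) (inA _ bA) ab.
- move=> _ /mapP[a + ->]; rewrite mem_enum => aA.
  have sn : size (drop d a) = n by rewrite size_drop size_tuple addKn.
  split=> //; move: (aA); rewrite inE => /andP[+ _]; rewrite inE.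
  rewrite (inA _ aA) momentum_cat sn [drop d _]/= -(inA _ aA).
  by congr (`|_| <= _); ring.
Qed.

(** The factor [k ^ n - 1], rather than [k ^ n], makes a zone of radius
    [rho >= M] impossible to re-enter. *)
Lemma momentum_bound g M y (a : seq 'I_k) : (forall x, `|g x| <= M) ->
  `|momentum g y a| <= (k%:R ^+ size a - 1) * M.
Proof.
move=> gM; have M0 : 0 <= M by apply: le_trans (gM 0).
elim: a y => [|j a IH] y /=; first by rewrite momentum_nil normr0 expr0 subrr mul0r.
rewrite momentum_cons exprS; set u := _ / _.
have K0 : 0 < k%:R ^+ size a :> R by rewrite exprn_gt0.
have := gM u; have := IH u; move: K0.
set K := k%:R ^+ size a => K0.
have K1 : 2 * (K * M) <= k%:R * K * M.
  by rewrite mulrA ler_wpM2r// ler_wpM2r// ltW.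
rewrite !ler_norml => /andP[A1 A2] /andP[B1 B2].
have := ler_wpM2l (ltW K0) B1; have := ler_wpM2l (ltW K0) B2.
by move=> ? ?; apply/andP; split; lra.
Qed.

Definition prefix_tuple m n (a : (m + n).-tuple 'I_k) : m.-tuple 'I_k :=
  Tuple (introT eqP (size_takel (leq_trans (leq_addr n m)
     (eq_leq (esym (size_tuple a)))))).

(** A momentum outside the zone never returns to it, so the prefixes of trapped
    words are trapped. The remainders are then counted with
    [card_prefix_class]. *)
Lemma multiplicityD g M rho m n : (forall x, `|g x| <= M) -> M <= rho ->
  (multiplicity g rho (m + n) <= multiplicity g rho m * multiplicity g rho n)%N.
Proof.
move=> gM Mrho.
have [y [zeta [y01 <-]]] := multiplicity_attained g rho (m + n).
set A := trap _ _ _ _ _.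
have K0 : 0 < k%:R ^+ n :> R by rewrite exprn_gt0.
have M0 : 0 <= M by apply: le_trans (gM 0).
pose B := trap g rho m y (zeta / k%:R ^+ n).
rewrite -sum1_card (partition_big (@prefix_tuple m n) (mem B)) /=; last first.
  move=> a; rewrite !inE => ha.
  have sd : size (drop m a) = n by rewrite size_drop size_tuple addKn.
  move: ha; rewrite -{1}(cat_take_drop m a) momentum_cat sd /= => ha.
  have hb := momentum_bound (endpoint y (take m a)) (drop m a) gM.
  rewrite sd in hb; move: ha hb.
  set u := momentum g y _; set v := momentum g _ _ => ha hb.
  have -> : u - zeta / k%:R ^+ n = (k%:R ^+ n * u - zeta) / k%:R ^+ n.
    by field; rewrite expf_neq0.
  rewrite normrM normfV (ger0_norm (ltW K0)) ler_pdivrMr//.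
  move: ha hb; rewrite !ler_norml => /andP[A1 A2] /andP[B1 B2].
  have k1 : 1 <= k%:R ^+ n :> R by rewrite exprn_ege1//; apply: le_trans k2; lra.
  have : 0 <= (rho - M) * (k%:R ^+ n - 1) by rewrite mulr_ge0 ?subr_ge0.
  by move=> ?; apply/andP; split; lra.
apply: (@leq_trans (\sum_(w in B) multiplicity g rho n)).
  apply: leq_sum => w _; rewrite sum1_card.
  apply: leq_trans (card_prefix_class g rho n zeta y01 (size_tuple w)).
  apply: subset_leq_card; apply/fintype.subsetP => a /andP[aA /eqP <-].
  by rewrite inE aA /=.
by rewrite sum_nat_const leq_mul2r trap_le ?orbT.
Qed.

(** For [x] and [z] in [[0, 1[], this says that their distance on the circle is
    at least [w]. *)
Definition far (w x z : R) := w <= `|x - z| <= 1 - w.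

(** The preimages of order [d] of a point are separated by [k ^ - d] on the
    circle, so an open arc of length [k ^ - d] contains at most one of them. *)
Lemma near_prefix_uniq y z (a b : seq 'I_k) : 0 <= y < 1 -> 0 <= z < 1 ->
  size a = size b ->
  ~~ far (2 * k%:R ^+ size a)^-1 (endpoint y a) z ->
  ~~ far (2 * k%:R ^+ size a)^-1 (endpoint y b) z -> a = b.
Proof.
move=> y01 z01 sab na nb; apply/eqP/negP => ab.
have cab : word_index a != word_index b by apply/eqP => /(word_index_inj hk sab) E; rewrite E eqxx in ab.
wlog lt : a b sab na nb {ab cab} / (word_index a < word_index b)%N.
  move=> W; have [lt|lt|E] := ltngtP (word_index a) (word_index b); last by rewrite E eqxx in cab.
    exact: (W a b).
  by apply: (W b a) => //; rewrite -?sab.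
set K := k%:R ^+ size a in na nb.
have K0 : 0 < K by rewrite exprn_gt0.
have E : endpoint y b - endpoint y a = ((word_index b)%:R - (word_index a)%:R) / K.
  by rewrite !endpointE// -sab -/K; field; rewrite gt_eqF.
have lo : K^-1 <= endpoint y b - endpoint y a.
  rewrite E -[X in X <= _]mul1r ler_wpM2r ?invr_ge0 ?(ltW K0)//.
  by rewrite lerBrDl natr1 ler_nat.
have hi : endpoint y b - endpoint y a <= 1 - K^-1.
  have -> : 1 - K^-1 = (K - 1) / K by field; rewrite lt0r_neq0.
  rewrite E.
  rewrite ler_wpM2r ?invr_ge0 ?(ltW K0)//.
  have := ler0n R (word_index a).
  have : (word_index b).+1%:R <= K by rewrite /K sab -natrX ler_nat word_index_lt.
  rewrite -natr1; lra.
move: na nb; rewrite /far invfM.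
have /andP[a0 a1] := endpoint_range hk a y01.
have /andP[b0 b1] := endpoint_range hk b y01.
have Ki : 0 < K^-1 by rewrite invr_gt0.
case/andP: z01 => z0 z1.
set X := endpoint y a in a0 a1 lo hi *; set Y := endpoint y b in b0 b1 lo hi *.
set e := K^-1 in Ki lo hi *.
rewrite !negb_and -!ltNge.
have [P1|P1] := ger0P (X - z); have [P2|P2] := ger0P (Y - z);
 case/orP => Q1; case/orP => Q2; lra.
Qed.

Lemma card_near_class g rho d n y y' z zeta : 0 <= y < 1 -> 0 <= y' < 1 ->
  0 <= z < 1 ->
  (#|[set a in trap g rho (d + n) y zeta |
       ~~ far (2 * k%:R ^+ d)^-1 (endpoint y' (take d a)) z]%SET|
     <= multiplicity g rho n)%N.
Proof.
move=> y01 y'01 z01; set A := [set a in _ | _]%SET.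
have [->|[a0 a0A]] := set_0Vmem A; first by rewrite cards0.
have st (a : (d + n).-tuple 'I_k) : size (take d a) = d.
  by rewrite size_takel// size_tuple leq_addr.
apply: leq_trans (card_prefix_class g rho n zeta y01 (st a0)).
apply: subset_leq_card; apply/fintype.subsetP => a.
move: a0A; rewrite !inE => /andP[_ na0] /andP[-> na] /=.
by apply/eqP; apply: (near_prefix_uniq y'01 z01); rewrite ?st.
Qed.

(** If [a] does not recur along [b], then a bump centred at the point reached by
    [a] at time [d] changes the momentum of [b] after time [D] only. When
    [0 < d <= D] the relation includes the time [d] itself, so every word recurs
    along the words with the same prefix of length [d]. *)
Definition recurs d D y n (a b : n.-tuple 'I_k) : bool :=
  [exists i : 'I_D, ~~ far (2 * k%:R ^+ d)^-1
     (endpoint y (take d a)) (endpoint y (take i.+1 b))].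

Lemma card_recurs g rho d D n y y' zeta (B : {set (d + n).-tuple 'I_k})
    (b : (d + n).-tuple 'I_k) :
  0 <= y < 1 -> 0 <= y' < 1 -> B \subset trap g rho (d + n) y zeta ->
  (#|[set a in B | recurs d D y' a b]%SET| <= D * multiplicity g rho n)%N.
Proof.
move=> y01 y'01 BT.
pose A (i : 'I_D) := [set a in trap g rho (d + n) y zeta |
  ~~ far (2 * k%:R ^+ d)^-1 (endpoint y' (take d a)) (endpoint y' (take i.+1 b))]%SET.
apply: (@leq_trans #|\bigcup_i A i|%SET).
  apply: subset_leq_card; apply/fintype.subsetP => a; rewrite inE => /andP[aB /existsP[i hi]].
  apply/finset.bigcupP; exists i => //; rewrite inE hi andbT.
  exact: (fintype.subsetP BT).
have : (#|\bigcup_i A i|%SET <= \sum_(i < D) #|A i|)%N.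
  elim/big_rec2: _ => [|i m S _ IH]; first by rewrite cards0.
  by rewrite cardsU; apply: leq_trans (leq_subr _ _) _; rewrite leq_add2l.
move/leq_trans; apply.
apply: (@leq_trans (\sum_(i < D) multiplicity g rho n)); last first.
  by rewrite sum_nat_const card_ord.
by apply: leq_sum => i _; apply: card_near_class => //; exact: endpoint_range.
Qed.

End Trapping.

(** * Transversality of the bump family *)

(** Reducing the coordinates in [J] modulo [K + 1] is injective on [S], since
    elements of [S] which agree off [J] are [K]-close. *)
Lemma card_ffun_close (L T K : nat) (J : {set 'I_L}) (S : {set {ffun 'I_L -> 'I_T}}) :
  (forall s s', s \in S -> s' \in S -> (forall l, l \notin J -> s l = s' l) ->
     forall l, (s l <= s' l + K)%N) ->
  (#|S| <= K.+1 ^ #|J| * T ^ (L - #|J|))%N.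
Proof.
move=> hS.
pose r (s : {ffun 'I_L -> 'I_T}) : {ffun 'I_L -> 'I_T} := [ffun l => if l \in J then
  Ordinal (leq_ltn_trans (leq_mod (s l) K.+1) (ltn_ord (s l))) else s l].
pose F (l : 'I_L) : {pred 'I_T} := if l \in J then [pred x : 'I_T | (x < K.+1)%N] else predT.
have rinj : {in S &, injective r}.
  move=> s s' sS s'S /ffunP rss.
  have out l : l \notin J -> s l = s' l.
    by move=> lJ; have := rss l; rewrite !ffunE (negbTE lJ).
  apply/ffunP => l; case: (boolP (l \in J)) => [lJ|/out//].
  have := rss l; rewrite !ffunE lJ => /(congr1 val) /= rl.
  have h1 := hS _ _ sS s'S out l.
  have h2 := hS _ _ s'S sS (fun l lJ => esym (out l lJ)) l.
  apply: ord_inj; move: rl h1 h2; set a := nat_of_ord _; set b := nat_of_ord _.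
  wlog ab : a b / (a <= b)%N.
    by move=> W; have [/W//|/ltnW ba] := leqP a b; move=> *; apply/esym/W.
  move=> /eqP; rewrite eq_sym eqn_mod_dvd// => /dvdnP[q E] _ bK.
  have : (q * K.+1 < K.+1)%N by rewrite -E; lia.
  by case: q E => [|q] E; [lia|rewrite mulSn; lia].
rewrite -(card_in_imset rinj).
apply: (@leq_trans #|family F|).
  apply: subset_leq_card; apply/fintype.subsetP => _ /imsetP[s sS ->].
  apply/familyP => l; rewrite ffunE /F; case: (l \in J) => //.
  by rewrite inE /= ltn_pmod.
rewrite card_family -[foldr _ _ _]/(foldr muln 1%N _).
have -> : foldr muln 1%N [seq #|F x| | x : 'I_L] = (\prod_(l < L) #|F l|)%N.
  by rewrite /image_mem foldrE big_map big_enum.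
rewrite (bigID (mem J)) /= leq_mul//.
  rewrite -prod_nat_const; apply: leq_prod => l lJ; rewrite /F lJ.
  rewrite -[X in (_ <= X)%N]card_ord.
  apply: (@leq_trans #|[pred x : 'I_T | (x < K.+1)%N]|) => //.
  rewrite cardE -(size_map val) -[X in (_ <= X)%N](size_iota 0).
  rewrite card_ord size_iota -[X in (_ <= X)%N](size_iota 0) uniq_leq_size//.
    by rewrite map_inj_uniq ?enum_uniq//; exact: val_inj.
  by move=> _ /mapP[x + ->]; rewrite mem_enum inE mem_iota.
rewrite (eq_bigr (fun=> T)); last by move=> l lJ; rewrite /F (negbTE lJ) card_ord.
rewrite prod_nat_const leq_eqVlt; apply/orP; left; apply/eqP; congr (_ ^ _)%N.
rewrite [LHS](eq_card (B := ~: J)%SET); last by move=> l; rewrite finset.in_setC.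
have := cardsC J; rewrite [X in _ = X -> _]card_ord.
by move=> /(congr1 (subn^~ #|J|)); rewrite addKn.
Qed.

Section Transversality.
Variables (R : realType) (k : nat).
Hypothesis hk : (2 <= k)%N.

Let k0 : (0 : R) < k%:R. Proof. by rewrite ltr0n; lia. Qed.
Let kn0 : k%:R != 0 :> R. Proof. by rewrite gt_eqF. Qed.
Let k2 : (2 : R) <= k%:R. Proof. by rewrite (ler_nat R 2 k). Qed.
Let kX (n : nat) : 0 < k%:R ^+ n :> R. Proof. by rewrite exprn_gt0. Qed.

(** Every point carries a bump that is large there and at most [k ^ - D] at
    distance [k ^ - d / 2]. A word reaching the point at time [d] is thus moved by
    an amount of order [k ^ - d], much more than the effect [k ^ - D] on words
    that stay away from it. *)
Definition bump_family (d D L : nat) (psi : 'I_L -> R -> R) :=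
  (forall l x, 0 <= psi l x <= 1) /\
  forall x, 0 <= x < 1 -> exists l, 2^-1 <= psi l x /\
    forall z, 0 <= z < 1 -> far (2 * k%:R ^+ d)^-1 x z ->
      psi l z <= (k%:R ^+ D)^-1.

Variables (d D L p : nat) (psi : 'I_L -> R -> R).
Hypotheses (d0 : (0 < d)%N) (dD : (d <= D)%N) (bumps : bump_family d D psi).
Hypothesis gap : 8 * p.+1%:R * k%:R ^+ d <= k%:R ^+ D :> R.
Definition nonrecurrent m (y : R) (f : {ffun 'I_p.+1 -> m.-tuple 'I_k}) : bool :=
  [forall j, forall j', (j != j') ==> ~~ recurs d D y (f j) (f j')].

Section FixedTuple.
Variables (n : nat) (y : R) (f : {ffun 'I_p.+1 -> (d + n).-tuple 'I_k}).
Hypotheses (y01 : 0 <= y < 1) (Dm : (D <= d + n)%N) (nf : nonrecurrent y f).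

Let m := (d + n)%N.

Let farf j j' i : j != j' -> (0 < i <= D)%N ->
  far (2 * k%:R ^+ d)^-1 (endpoint y (take d (f j))) (endpoint y (take i (f j'))).
Proof.
move=> jj'; case: i => // i /= iD; move/forallP: nf => /(_ j)/forallP/(_ j').
by rewrite jj' /= negb_exists => /forallP/(_ (Ordinal iD)); rewrite negbK.
Qed.

(** Give each word a bump centred at the point it reaches at time [d]. The other
    words avoid this point up to time [D] by nonrecurrence. *)
Lemma private_bumps : exists l : 'I_p.+1 -> 'I_L,
  [/\ injective l,
      forall j, k%:R ^+ m / (2 * k%:R ^+ d) <= momentum (psi (l j)) y (f j)
    & forall j j', j != j' ->
        0 <= momentum (psi (l j)) y (f j') <= 2 * k%:R ^+ m / k%:R ^+ D].
Proof.
have [psi01 bumpx] := bumps.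
have psi0 l x : 0 <= psi l x by case/andP: (psi01 l x).
have [l hl] := choice (fun j : 'I_p.+1 => bumpx (endpoint y (take d (f j)))
                                     (endpoint_range hk _ y01)).
have sf j : size (f j) = m by rewrite size_tuple.
exists l; split.
- move=> j j' ljj'; apply/eqP/negPn/negP => jj'.
  have [h1 h2] := hl j; have [h3 h4] := hl j'.
  have := h2 _ (endpoint_range hk _ y01) (farf jj' (i := d) _).
  rewrite d0 dD ljj' => /(_ isT) h5.
  have : k%:R ^+ D <= 2 :> R.
    have := le_trans h3 h5; rewrite lef_pV2 ?posrE//.
  move: gap; have : (2 : R) <= k%:R ^+ d.
    by apply: le_trans k2 _; rewrite -{1}[k%:R]expr1 ler_eXn2l//; apply: lt_le_trans k2; lra.
  have : (1 : R) <= p.+1%:R by rewrite ler1n.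
  have key (P K Kd : R) : 1 <= P -> 2 <= Kd -> 8 * P * Kd <= K -> K <= 2 -> False by nra.
  exact: key.
- move=> j; have [h1 _] := hl j.
  have := @momentum_ge R k (psi (l j)) y (f j) d (psi0 (l j)).
  rewrite sf d0 leq_addr => /(_ isT); apply: le_trans.
  rewrite exprB ?leq_addr ?unitfE//.
  rewrite [X in X <= _](_ : _ = k%:R ^+ m / k%:R ^+ d * 2^-1); last first.
    by field; rewrite expf_neq0.
  by rewrite ler_wpM2l// divr_ge0 ?ltW.
- move=> j j' jj'; rewrite momentum_ge0//=.
  have [_ h2] := hl j.
  have := @momentum_le R k hk (psi (l j)) y (f j') (k%:R ^+ D)^-1 D.
  have Dm' : (D <= m)%N := Dm.
  rewrite sf (exprB Dm') ?unitfE//.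
  have E : k%:R ^+ m * (k%:R ^+ D)^-1 + k%:R ^+ m / k%:R ^+ D = 2 * k%:R ^+ m / k%:R ^+ D :> R by ring.
  rewrite E; apply=> // i iD; apply: h2; [exact: endpoint_range|exact: farf].
Qed.

(** Consider the largest coordinate of [v] and the word to which its bump belongs.
    In the difference of momenta for this word that coordinate has a coefficient
    of order [k ^ (m - d)], which dominates the sum of the others because
    [k ^ D >= 8 * (p + 1) * k ^ d]. *)
Lemma transversality (l : 'I_p.+1 -> 'I_L) (v : 'I_L -> R) (sigma : R) :
  (forall j, k%:R ^+ m / (2 * k%:R ^+ d) <= momentum (psi (l j)) y (f j)) ->
  (forall j j', j != j' ->
     0 <= momentum (psi (l j)) y (f j') <= 2 * k%:R ^+ m / k%:R ^+ D) ->
  (forall i, v i != 0 -> exists2 j, j != ord0 & i = l j) ->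
  (forall j, `|\sum_i v i * (momentum (psi i) y (f j) - momentum (psi i) y (f ord0))|
     <= sigma) ->
  forall i, `|v i| <= 4 * sigma * k%:R ^+ d / k%:R ^+ m.
Proof.
move=> diag off supp close i0.
have s0 : 0 <= sigma by apply: le_trans (close ord0).
pose i := [arg max_(i > i0) `|v i|]%O.
have imax i' : `|v i'| <= `|v i|.
  by rewrite /i; case: arg_maxP => // x _ xm; exact: xm.
apply: le_trans (imax i0) _.
have [->|vi0] := eqVneq (v i) 0.
  by rewrite normr0 divr_ge0 ?mulr_ge0// ltW.
have [j j0 ij] := supp _ vi0.
have := close j; rewrite (bigD1 i)//=.
set A := v i * _; set S := \sum_(_ | _) _ => AS.
set V := `|v i| in imax *.
have V0 : 0 <= V by exact: normr_ge0.
set E := 2 * k%:R ^+ m / k%:R ^+ D in off.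
have E0 : 0 <= E by rewrite divr_ge0 ?mulr_ge0// ltW.
(* Off the index [i] only the [p] bumps attached to the words [f j], [j != ord0], contribute. *)
have SE : `|S| <= p%:R * (V * E).
  apply: le_trans (ler_norm_sum _ _ _) _.
  pose J := [set l j | j in [set j | j != ord0]]%SET.
  have JP : (#|J| <= p)%N.
    apply: leq_trans (leq_imset_card _ _) _.
    rewrite (_ : [set j | j != ord0]%SET = [set~ ord0]%SET) ?cardsC1 ?card_ord//.
    by apply/setP => x; rewrite !inE.
  rewrite (bigID (mem J)) /= [X in _ + X]big1 ?addr0; last first.
    move=> i' /andP[_ i'J]; have [->|/supp[j' j'0 i'j']] := eqVneq (v i') 0.
      by rewrite mul0r normr0.
    by move: i'J; rewrite i'j' imset_f// inE.
  apply: (@le_trans _ _ (\sum_(i' in J) V * E)); last first.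
    by rewrite sumr_const -[V * E *+ _]mulr_natl ler_wpM2r ?ler_nat// mulr_ge0.
  rewrite [X in _ <= X](bigID (fun i' => i' == i)) /= -[X in X <= _]add0r lerD//.
    by apply: sumr_ge0 => *; rewrite mulr_ge0.
  rewrite [X in _ <= X](eq_bigl (fun i' => (i' != i) && (i' \in J))); last by move=> ?; rewrite andbC.
  apply: ler_sum => i' /andP[i'i /imsetP[j' j'0 i'j']]; rewrite normrM.
  rewrite ler_pM// i'j'.
  have jj' : j' != j by apply: contraNneq i'i => E'; rewrite i'j' E' ij.
  have /andP[a1 a2] := off _ _ jj'.
  have /andP[b1 b2] : 0 <= momentum (psi (l j')) y (f ord0) <= E.
    by apply: off; move: j'0; rewrite inE.
  by rewrite ler_norml; apply/andP; split; lra.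
have AE : V * (k%:R ^+ m / (2 * k%:R ^+ d) - E) <= `|A|.
  rewrite normrM ler_wpM2l// ij; apply: le_trans (ler_norm _).
  by apply: lerB => //; case/andP: (off _ _ j0).
have pE : p.+1%:R * E <= k%:R ^+ m / (4 * k%:R ^+ d).
  have -> : p.+1%:R * E = k%:R ^+ m * (p.+1%:R * 2 / k%:R ^+ D) by rewrite /E; ring.
  rewrite ler_wpM2l ?(ltW (kX _))// ler_pdivrMr// [_^-1 * _]mulrC ler_pdivlMr ?mulr_gt0//.
  by apply: le_trans gap; lra.
have AS' : `|A| - `|S| <= sigma by apply: le_trans (lerB_normD _ _) AS.
have fin : V * (k%:R ^+ m / (4 * k%:R ^+ d)) <= sigma.
  have := ler_wpM2l (normr_ge0 (v i)) pE; rewrite -/V -natr1.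
  have e : k%:R ^+ m / (2 * k%:R ^+ d) = 2 * (k%:R ^+ m / (4 * k%:R ^+ d)) :> R.
    by field; rewrite expf_neq0.
  move: AE SE AS'; rewrite e; lra.
rewrite ler_pdivlMr//.
move: fin; rewrite mulrA ler_pdivrMr ?mulr_gt0// => fin.
by apply: le_trans fin _; rewrite mulrCA mulrA.
Qed.

End FixedTuple.

End Transversality.

(** * Coherent tuples of words *)

Section Counting.
Variables (R : realType) (k : nat).
Hypothesis hk : (2 <= k)%N.

Let k0 : (0 : R) < k%:R. Proof. by rewrite ltr0n; lia. Qed.
Let kn0 : k%:R != 0 :> R. Proof. by rewrite gt_eqF. Qed.
Let kX (n : nat) : 0 < k%:R ^+ n :> R. Proof. by rewrite exprn_gt0. Qed.

Definition perturb L (psi : 'I_L -> R -> R) (g : R -> R) (t : 'I_L -> R) : R -> R :=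
  fun x => g x + \sum_l t l * psi l x.

Definition grid_param L T (delta : R) (s : {ffun 'I_L -> 'I_T}) : 'I_L -> R :=
  fun l => delta * (s l)%:R / T%:R.

Definition coherent p m (sigma : R) (g : R -> R) (y : R)
    (f : {ffun 'I_p.+1 -> m.-tuple 'I_k}) : bool :=
  [forall j, `|momentum g y (f j) - momentum g y (f ord0)| <= sigma].

Variables (d D p : nat).

(** For each ordered pair of distinct indices, [card_recurs] and
    [card_ffun_pair] bound the proportion of tuples recurring at that pair by
    [D * multiplicity n] over the number of trapped words. There are at most
    [(p + 1) ^ 2] such pairs. *)
Lemma many_nonrecurrent (g : R -> R) (rho : R) n (y y' zeta : R) : 0 <= y < 1 -> 0 <= y' < 1 ->
  (2 * p.+1 ^ 2 * D * multiplicity k g rho n <= #|trap k g rho (d + n) y zeta|)%N ->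
  (#|trap k g rho (d + n) y zeta| ^ p.+1 <=
    2 * #|[set f : {ffun 'I_p.+1 -> (d + n).-tuple 'I_k} |
        [forall i, f i \in trap k g rho (d + n) y zeta] &&
        nonrecurrent d D y' f]%SET|)%N.
Proof.
move=> y01 y'01; set B := trap _ _ _ _ _ _ => hB.
have [B0|B0] := posnP #|B|; first by rewrite B0 exp0n.
pose all := [set f : {ffun 'I_p.+1 -> (d + n).-tuple 'I_k} | [forall i, f i \in B]]%SET.
pose bad (jj : 'I_p.+1 * 'I_p.+1) := [set f : {ffun 'I_p.+1 -> (d + n).-tuple 'I_k} |
  [&& jj.1 != jj.2, [forall i, f i \in B] & recurs d D y' (f jj.1) (f jj.2)]]%SET.
set good := [set f | _]%SET.
have allE : #|all| = (#|B| ^ p.+1)%N.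
  rewrite -[X in (_ ^ X)%N](card_ord p.+1) -card_ffun_on; apply: eq_card => f.
  by rewrite inE; apply/forallP/ffun_onP.
have cover : all \subset good :|: \bigcup_jj bad jj.
  apply/fintype.subsetP => f; rewrite !inE => fB; rewrite fB /=.
  case: (boolP (nonrecurrent _ _ _ _)) => //=; rewrite negb_forall => /existsP[j].
  rewrite negb_forall => /existsP[j']; rewrite negb_imply negbK => /andP[jj' rf].
  by apply/finset.bigcupP; exists (j, j') => //; rewrite inE /= jj' fB.
have cardbad jj : (#|bad jj| * #|B| <= D * multiplicity k g rho n * #|B| ^ p.+1)%N.
  have [E|jj'] := eqVneq jj.1 jj.2.
    by rewrite (_ : bad jj = finset.set0)%SET ?cards0//; apply/setP => f; rewrite !inE E eqxx.
  apply: leq_trans (card_ffun_pair jj' (fun b bB => card_recurs hk D b y01 y'01 (fintype.subxx B))).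
  rewrite leq_mul2r; apply/orP; right; apply: subset_leq_card; apply/fintype.subsetP => f.
  by rewrite !inE => /and3P[_ -> ->].
have cardbads : (#|\bigcup_jj bad jj|%SET <= \sum_jj #|bad jj|)%N.
  elim/big_rec2: _ => [|i m S _ IH]; first by rewrite cards0.
  by rewrite cardsU; apply: leq_trans (leq_subr _ _) _; rewrite leq_add2l.
have sumbad : ((\sum_jj #|bad jj|) * #|B| <= p.+1 ^ 2 * (D * multiplicity k g rho n * #|B| ^ p.+1))%N.
  rewrite big_distrl /=; apply: (@leq_trans (\sum_(jj : 'I_p.+1 * 'I_p.+1) D * multiplicity k g rho n * #|B| ^ p.+1)%N); first by apply: leq_sum => jj _; exact: cardbad.
  by rewrite sum_nat_const card_prod card_ord mulnn.
have h2 : (2 * (\sum_jj #|bad jj|) <= #|B| ^ p.+1)%N.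
  rewrite -(leq_pmul2r B0) -mulnA.
  apply: leq_trans (leq_mul (leqnn 2) sumbad) _.
  have -> : (2 * (p.+1 ^ 2 * (D * multiplicity k g rho n * #|B| ^ p.+1)) =
    #|B| ^ p.+1 * (2 * p.+1 ^ 2 * D * multiplicity k g rho n))%N by lia.
  by rewrite leq_mul2l hB orbT.
have := subset_leq_card cover; rewrite allE.
have : (#|good :|: \bigcup_jj bad jj|%SET <= #|good| + #|\bigcup_jj bad jj|%SET)%N.
  by rewrite cardsU leq_subr.
lia.
Qed.

(** The trapped words at an optimal base point stay coherent at the closest grid
    point to its left, at the cost of enlarging the radius by the Lipschitz
    constant of [g]. *)
Lemma grid_nonrecurrent (g : R -> R) (rho Lip : R) n : 0 <= Lip ->
  (forall u v, `|g u - g v| <= Lip * `|u - v|) ->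
  (2 * p.+1 ^ 2 * D * multiplicity k g rho n <= multiplicity k g rho (d + n))%N ->
  exists c : 'I_(k ^ (d + n)), let y := c%:R / k%:R ^+ (d + n) in
  (multiplicity k g rho (d + n) ^ p.+1 <=
    2 * #|[set f : {ffun 'I_p.+1 -> (d + n).-tuple 'I_k} |
        nonrecurrent d D y f && coherent (2 * (rho + Lip)) g y f]%SET|)%N.
Proof.
move=> L0 gL hN.
have [y [zeta [/andP[y0 y1] NE]]] := multiplicity_attained k g rho (d + n).
set m := (d + n)%N in NE hN *.
have ym0 : 0 <= y * k%:R ^+ m by rewrite mulr_ge0// ltW.
have /andP[t1 t2] := truncn_itv ym0.
set c := Num.truncn (y * k%:R ^+ m) in t1 t2.
have cm : (c < k ^ m)%N.
  rewrite -(ltr_nat R) natrX; apply: le_lt_trans t1 _.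
  by rewrite -[X in _ < X]mul1r ltr_pM2r.
exists (Ordinal cm) => /=; set y' := c%:R / _.
have y'01 : 0 <= y' < 1.
  by rewrite divr_ge0 ?(ltW (kX _))//= ltr_pdivrMr// mul1r -natrX ltr_nat.
have yy' : `|y' - y| <= (k%:R ^+ m)^-1.
  have -> : y' - y = - ((y * k%:R ^+ m - c%:R) / k%:R ^+ m).
    by rewrite /y'; field; rewrite expf_neq0.
  rewrite normrN ger0_norm ?divr_ge0 ?subr_ge0 ?(ltW (kX _))//.
  rewrite -[X in _ <= X]mul1r ler_wpM2r ?invr_ge0 ?(ltW (kX _))//.
  by move: t2; rewrite -natr1; lra.
rewrite -NE in hN *.
apply: leq_trans (many_nonrecurrent _ y'01 hN) _; first by rewrite y0.
rewrite leq_mul2l /=; apply: subset_leq_card; apply/fintype.subsetP => f.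
rewrite !inE => /andP[/forallP fB ->] /=.
have key j : `|momentum g y' (f j) - zeta| <= rho + Lip.
  have := fB j; rewrite inE => h1.
  have := momentum_lip hk y' y (f j) L0 gL; rewrite size_tuple => h2.
  have h3 : k%:R ^+ m * Lip * `|y' - y| <= Lip.
    rewrite mulrAC -[X in _ <= X]mul1r ler_wpM2r//.
    by rewrite mulrC -ler_pdivlMr// mul1r.
  have := le_trans h2 h3; move: h1.
  rewrite !ler_norml => /andP[? ?] /andP[? ?]; apply/andP; split; lra.
apply/forallP => j; have := key j; have := key ord0.
rewrite !ler_norml => /andP[? ?] /andP[? ?]; apply/andP; split; lra.
Qed.

Variables (L : nat) (psi : 'I_L -> R -> R).
Hypotheses (d0 : (0 < d)%N) (dD : (d <= D)%N) (bumps : bump_family k d D psi).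
Hypothesis gap : 8 * p.+1%:R * k%:R ^+ d <= k%:R ^+ D :> R.

(** Two parameters which make [f] coherent and agree off the [p] bumps attached to
    the words of [f] differ by at most [8 * sigma * k ^ d / k ^ (d + n)] in each
    coordinate, by transversality. The grid has mesh [delta / T]. *)
Lemma card_coherent_params T K n (y : R) (f : {ffun 'I_p.+1 -> (d + n).-tuple 'I_k})
    (delta sigma : R) (g : R -> R) :
  0 <= y < 1 -> (D <= d + n)%N -> nonrecurrent d D y f -> (0 < T)%N -> 0 < delta ->
  8 * sigma * k%:R ^+ d * T%:R / (delta * k%:R ^+ (d + n)) < K.+1%:R ->
  #|[set s : {ffun 'I_L -> 'I_T} |
      coherent sigma (perturb psi g (grid_param delta s)) y f]%SET|%:R
  <= (K.+1%:R / T%:R) ^+ p * T%:R ^+ L :> R.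
Proof.
move=> y01 Dm nf T0 delta0 hK.
have [l [linj diag off]] := private_bumps hk d0 dD bumps gap y01 Dm nf.
pose J := [set l j | j in [set j | j != ord0]]%SET.
have JE : #|J| = p.
  rewrite card_imset// (_ : [set j | j != ord0]%SET = [set~ ord0]%SET) ?cardsC1 ?card_ord//.
  by apply/setP => x; rewrite !inE.
have pL : (p <= L)%N by rewrite -JE -[X in (_ <= X)%N]card_ord max_card.
have T0' : (0 : R) < T%:R by rewrite ltr0n.
set S := [set s | _]%SET.
have := @card_ffun_close L T K J S; rewrite JE => HS.
have {}HS : (#|S| <= K.+1 ^ p * T ^ (L - p))%N.
  apply: HS => s s'; rewrite !inE => /forallP cs /forallP cs' ss'.
  pose v i : R := grid_param delta s i - grid_param delta s' i.
  have supp i : v i != 0 -> exists2 j, j != ord0 & i = l j.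
    move=> vi; case: (boolP (i \in J)) => [/imsetP[j]|/ss' E].
      by rewrite inE => ? ?; exists j.
    by move: vi; rewrite /v /grid_param E subrr eqxx.
  have close j : `|\sum_i v i * (momentum (psi i) y (f j) - momentum (psi i) y (f ord0))|
      <= 2 * sigma.
    have := cs j; have := cs' j; rewrite !momentum_sum.
    set A := momentum g _ _; set B := momentum g _ _ => h h'.
    have -> : \sum_i v i * (momentum (psi i) y (f j) - momentum (psi i) y (f ord0)) =
      (\sum_i grid_param delta s i * momentum (psi i) y (f j)
      - \sum_i grid_param delta s i * momentum (psi i) y (f ord0))
      - (\sum_i grid_param delta s' i * momentum (psi i) y (f j)
      - \sum_i grid_param delta s' i * momentum (psi i) y (f ord0)).
      by rewrite -!sumrB; apply: eq_bigr => i _; rewrite /v; ring.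
    move: h h'; rewrite !ler_norml => /andP[? ?] /andP[? ?].
    by apply/andP; split; lra.
  have bound := transversality hk gap diag off supp close.
  move=> i; rewrite -(ler_nat R) natrD.
  have {}bound : `|(s i)%:R - (s' i)%:R| < K.+1%:R :> R.
    apply: (le_lt_trans _ hK).
    have h : `|v i| = `|(s i)%:R - (s' i)%:R| * (delta / T%:R).
      have -> : v i = ((s i)%:R - (s' i)%:R) * (delta / T%:R) by rewrite /v /grid_param; ring.
      by rewrite normrM (ger0_norm (x := delta / _)) ?divr_ge0 ?ltW.
    have := bound i; rewrite h; move: (kX (d + n)) (T0').
    set N := `|_|; set M := k%:R ^+ (d + n); set t := T%:R => M0 t0.
    rewrite ler_pdivlMr// ler_pdivlMr ?mulr_gt0//.
    have -> : N * (delta / t) * M = N * (delta * M) / t by ring.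
    rewrite ler_pdivrMr// => le1; apply: le_trans le1 _.
    by rewrite le_eqVlt; apply/orP; left; apply/eqP; ring.
  have : ((s i) < (s' i) + K.+1)%N.
    rewrite -(ltr_nat R) natrD; move: bound; rewrite ltr_norml => /andP[_]; lra.
  by rewrite addnS ltnS -natrD ler_nat.
apply: (@le_trans _ _ (K.+1 ^ p * T ^ (L - p))%N%:R); first by rewrite ler_nat.
rewrite natrM !natrX expr_div_n -{2}(subnKC pL) exprD.
set a := _ ^+ p; set b := _ ^+ p.
have b0 : b != 0 by rewrite expf_neq0// gt_eqF.
by rewrite [X in _ <= X](_ : _ = a * T%:R ^+ (L - p)); [|field].
Qed.

End Counting.

(** * The moment estimate *)

Section Perturbation.
Variables (R : realType) (k : nat).
Hypothesis hk : (2 <= k)%N.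

Let k0 : (0 : R) < k%:R. Proof. by rewrite ltr0n; lia. Qed.
Let kn0 : k%:R != 0 :> R. Proof. by rewrite gt_eqF. Qed.
Let kX (n : nat) : 0 < k%:R ^+ n :> R. Proof. by rewrite exprn_gt0. Qed.

(** Otherwise [u] grows by at most [gamma ^ (I * d)] from [u n0 <= k ^ n0], which
    stays below [gamma ^ (2 * (n0 + I * d))] as soon as [k ^ n0 <= gamma ^ I]. The
    bound on [i] matters: it makes finitely many lengths suffice for all
    parameters at once. *)
Lemma growth_step (u : nat -> nat) (gamma : R) n0 d I : 1 < gamma -> (0 < d)%N ->
  (u n0 <= k ^ n0)%N -> k%:R ^+ n0 <= gamma ^+ I ->
  (gamma ^+ 2) ^+ (n0 + I * d) < (u (n0 + I * d)%N)%:R ->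
  exists i : 'I_I, gamma ^+ d * (u (n0 + i * d)%N)%:R <= (u (d + (n0 + i * d))%N)%:R.
Proof.
move=> g1 d0 u0 kI big; apply: contrapT => nex.
have g0 : 0 < gamma by apply: lt_trans g1.
have step i : (i <= I)%N -> (u (n0 + i * d)%N)%:R <= (gamma ^+ d) ^+ i * k%:R ^+ n0.
  elim: i => [|i IH] iI; first by rewrite mul0n addn0 expr0 mul1r -natrX ler_nat.
  have lt : (u (d + (n0 + i * d))%N)%:R < gamma ^+ d * (u (n0 + i * d)%N)%:R.
    by rewrite ltNge; apply/negP => le1; apply: nex; exists (Ordinal iI).
  rewrite mulSn addnCA; apply: le_trans (ltW lt) _.
  by rewrite exprS -mulrA ler_wpM2l ?IH ?(ltnW iI)// exprn_ge0 ?ltW.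
have := lt_le_trans big (step I (leqnn I)); apply/negP; rewrite -leNgt.
rewrite -!exprM.
apply: (@le_trans _ _ (gamma ^+ (d * I) * gamma ^+ I)).
  by rewrite ler_wpM2l// exprn_ge0// ltW.
by rewrite -exprD ler_weXn2l ?(ltW g1)//; nia.
Qed.

Lemma sum_half_powers I : \sum_(i < I) (2^-1 : R) ^+ i.+1 <= 1.
Proof.
suff -> : \sum_(i < I) (2^-1 : R) ^+ i.+1 = 1 - 2^-1 ^+ I.
  by rewrite gerBl exprn_ge0.
elim: I => [|I IH]; first by rewrite big_ord0 expr0 subrr.
by rewrite big_ord_recr /= IH exprS; lra.
Qed.

Variables (d D L p : nat) (psi : 'I_L -> R -> R) (gamma : R).
Hypotheses (d0 : (0 < d)%N) (dD : (d <= D)%N) (bumps : bump_family k d D psi).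
Hypothesis gap : 8 * p.+1%:R * k%:R ^+ d <= k%:R ^+ D :> R.
Hypothesis g1 : 1 < gamma.
Hypothesis gp : 2 * k%:R ^+ 2 <= (gamma ^+ 2) ^+ p.+1.
Hypothesis gd : (2 * p.+1 ^ 2 * D)%:R <= gamma ^+ d.

Let g0 : 0 < gamma. Proof. by apply: lt_trans g1. Qed.

Definition coherent_tuples m (sigma : R) (g : R -> R) (y : R) :=
  [set f : {ffun 'I_p.+1 -> m.-tuple 'I_k} |
    nonrecurrent d D y f && coherent sigma g y f]%SET.

Definition coherent_total m (sigma : R) (g : R -> R) : nat :=
  (\sum_(c < k ^ m) #|coherent_tuples m sigma g (c%:R / k%:R ^+ m)|)%N.

(** Exchange the sums over parameters and over tuples, and apply
    [card_coherent_params] to each of the [k ^ (m * (p + 1))] tuples and each of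
    the [k ^ m] base points. *)
Lemma coherent_tuples_le T n (delta sigma : R) (g : R -> R) :
  let m := (d + n)%N in
  (D <= m)%N -> (k ^ m <= T)%N -> 0 < delta -> 0 <= sigma ->
  \sum_(s : {ffun 'I_L -> 'I_T})
      (coherent_total m sigma (perturb psi g (grid_param delta s)))%:R
  <= (k%:R ^+ 2) ^+ m * (8 * sigma * k%:R ^+ d / delta + 1) ^+ p * T%:R ^+ L :> R.
Proof.
move=> m Dm kT delta0 sigma0.
have T0 : (0 < T)%N by apply: leq_trans kT; rewrite expn_gt0 (ltnW hk).
have T0' : 0 < T%:R :> R by rewrite ltr0n.
pose gs (s : {ffun 'I_L -> 'I_T}) := perturb psi g (grid_param delta s).
set C := _ + 1.
have C0 : 0 <= C by rewrite addr_ge0// divr_ge0 ?(ltW delta0)// !mulr_ge0// ltW.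
pose X := 8 * sigma * k%:R ^+ d * T%:R / (delta * k%:R ^+ m).
pose K := Num.truncn X.
have X0 : 0 <= X by rewrite divr_ge0 ?mulr_ge0// ltW.
have hK : X < K.+1%:R by exact: truncnS_gt.
have KT : K.+1%:R / T%:R <= C / k%:R ^+ m.
  rewrite ler_pdivrMr// -natr1; have /andP[K1 _] := truncn_itv X0.
  apply: le_trans (lerD K1 (lexx 1)) _; rewrite /C mulrDl mul1r mulrDl lerD//.
    rewrite /X le_eqVlt; apply/orP; left; apply/eqP; field.
    by rewrite expf_neq0// gt_eqF.
  by rewrite mulrC ler_pdivlMr// mul1r -natrX ler_nat.
rewrite -natr_sum /coherent_total exchange_big /= natr_sum.
pose N := (k ^ m)%N.
have bound (c : 'I_N) : (\sum_s #|coherent_tuples m sigma (gs s) (c%:R / k%:R ^+ m)|)%N%:R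
   <= (N ^ p.+1)%N%:R * ((C / k%:R ^+ m) ^+ p * T%:R ^+ L) :> R.
  set y : R := c%:R / _.
  have y01 : 0 <= y < 1.
    by rewrite divr_ge0 ?(ltW (kX _))//= ltr_pdivrMr// mul1r -natrX ltr_nat.
  have -> : (\sum_s #|coherent_tuples m sigma (gs s) y| =
    \sum_(f : {ffun 'I_p.+1 -> m.-tuple 'I_k} | nonrecurrent d D y f)
      #|[set s | coherent sigma (gs s) y f]%SET|)%N.
    under eq_bigr => s _ do rewrite -sum1_card.
    under [RHS]eq_bigr => f _ do rewrite -sum1_card.
    rewrite (exchange_big_dep (fun f => nonrecurrent d D y f)) /=; last first.
      by move=> s f _; rewrite inE => /andP[].
    by apply: eq_bigr => f nf; apply: eq_bigl => s; rewrite !inE nf.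
  rewrite natr_sum.
  apply: (@le_trans _ _ (\sum_(f : {ffun 'I_p.+1 -> m.-tuple 'I_k}) (C / k%:R ^+ m) ^+ p * T%:R ^+ L)); last first.
    rewrite sumr_const -[X in X <= _]mulr_natl ler_wpM2r ?mulr_ge0 ?exprn_ge0 ?divr_ge0// ?(ltW (kX _))//.
    by rewrite ler_nat card_ffun card_tuple !card_ord.
  rewrite [X in _ <= X](bigID (fun f => nonrecurrent d D y f)) /=.
  rewrite -[X in X <= _]addr0 lerD//; last first.
    by apply: sumr_ge0 => f _; rewrite mulr_ge0 ?exprn_ge0 ?divr_ge0 ?(ltW (kX _)).
  apply: ler_sum => f nf.
  apply: le_trans (card_coherent_params hk d0 dD bumps gap g y01 Dm nf T0 delta0 hK) _.
  by rewrite ler_wpM2r ?exprn_ge0// lerXn2r ?nnegrE ?divr_ge0 ?(ltW (kX _)).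
apply: (@le_trans _ _ (\sum_(c < N)
    (N ^ p.+1)%N%:R * ((C / k%:R ^+ m) ^+ p * T%:R ^+ L))).
  by apply: ler_sum => c _; exact: bound.
rewrite sumr_const card_ord -[X in X <= _]mulr_natl /N !natrX.
rewrite [(k%:R ^+ 2) ^+ m]exprAC expr_div_n exprS.
have b0 : (k%:R ^+ m) ^+ p != 0 :> R by rewrite !expf_neq0.
move: b0; set a := k%:R ^+ m; set b := a ^+ p => b0.
rewrite le_eqVlt; apply/orP; left; apply/eqP; field; exact: b0.
Qed.

(** If every grid parameter violated the conclusion, each would produce
    [gamma ^ (2 * m * (p + 1)) / 2] coherent tuples for one of [I] lengths
    [m >= n0]. By [coherent_tuples_le] and the choice of [p], the proportion of
    parameters doing so at length [m] is [O (2 ^ - m)], where the implied constant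
    does not depend on [n0]. For [n0] large these proportions add up to less than
    1. *)
Lemma perturbation (Lpsi : R) (g : R -> R) (Lip rho delta : R) :
  0 <= Lpsi -> (forall l u v, `|psi l u - psi l v| <= Lpsi * `|u - v|) ->
  0 <= Lip -> (forall u v, `|g u - g v| <= Lip * `|u - v|) ->
  0 <= rho -> 0 < delta ->
  exists t : 'I_L -> R, (forall l, 0 <= t l <= delta) /\
    exists2 n, (0 < n)%N &
      (multiplicity k (perturb psi g t) rho n)%:R <= (gamma ^+ 2) ^+ n.
Proof.
move=> Lpsi0 psiL Lip0 gL rho0 delta0; apply: contrapT => nex.
pose Lip' := Lip + L%:R * (delta * Lpsi).
have Lip'0 : 0 <= Lip' by rewrite addr_ge0// !mulr_ge0// ltW.
pose sigma := 2 * (rho + Lip').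
have sigma0 : 0 <= sigma by rewrite mulr_ge0// addr_ge0.
(* [C * T / k ^ m] bounds the number of grid values left for one coordinate. *)
pose C := 8 * sigma * k%:R ^+ d / delta + 1.
have C0 : 0 <= C.
  apply: addr_ge0 => //; apply: divr_ge0; last exact: ltW.
  apply: mulr_ge0; last exact: ltW.
  exact: mulr_ge0.
have [n1 hn1] : exists n, 2 * C ^+ p + 1 <= 2 ^+ n by apply: expr_unbounded; lra.
pose n0 := (D + n1)%N.
have Dn0 : (D <= n0)%N by rewrite leq_addr.
have hn0 : 2 * C ^+ p < 2 ^+ n0.
  apply: (@lt_le_trans _ _ (2 ^+ n1)); first by apply: lt_le_trans hn1; rewrite ltrDl.
  by rewrite ler_weXn2l ?leq_addl//; lra.
have [I hI] : exists I, k%:R ^+ n0 <= gamma ^+ I by exact: expr_unbounded.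
pose m (i : 'I_I) := (d + (n0 + i * d))%N.
(* The grid must be at least as fine as [k ^ - m] for all the lengths [m i]. *)
have [T [T0 mI]] : exists T, (0 < T)%N /\ forall i : 'I_I, (k ^ m i <= T)%N.
  exists (k ^ (n0 + I * d))%N; split=> [|i]; first by rewrite expn_gt0 (ltnW hk).
  by rewrite leq_exp2l// /m addnCA leq_add2l -mulSn leq_mul2r ltn_ord orbT.
have T0' : 0 < T%:R :> R by rewrite ltr0n.
pose gs (s : {ffun 'I_L -> 'I_T}) := perturb psi g (grid_param delta s).
have ts s l : 0 <= @grid_param R L T delta s l <= delta.
  rewrite /grid_param divr_ge0 ?mulr_ge0 ?(ltW delta0)//= ler_pdivrMr//.
  by rewrite ler_wpM2l ?(ltW delta0)// ler_nat ltnW.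
have big s n : (0 < n)%N -> (gamma ^+ 2) ^+ n < (multiplicity k (gs s) rho n)%:R.
  move=> n_gt0; rewrite ltNge; apply/negP => le1; apply: nex.
  by exists (grid_param delta s); split=> //; exists n.
have gsL s u v : `|gs s u - gs s v| <= Lip' * `|u - v|.
  rewrite /gs /perturb.
  have -> : g u + \sum_l grid_param delta s l * psi l u - (g v + \sum_l grid_param delta s l * psi l v)
    = (g u - g v) + \sum_l grid_param delta s l * (psi l u - psi l v).
    under [X in _ = _ + X]eq_bigr do rewrite mulrBr.
    by rewrite sumrB; ring.
  apply: le_trans (ler_normD _ _) _; rewrite mulrDl lerD//.
  apply: le_trans (ler_norm_sum _ _ _) _.
  apply: (@le_trans _ _ (\sum_(l < L) delta * Lpsi * `|u - v|)).
    apply: ler_sum => l _; have /andP[t0 t1] := ts s l.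
    by rewrite normrM ger0_norm// -mulrA ler_pM.
  by rewrite sumr_const card_ord -[X in X <= _]mulr_natl !mulrA.
pose W i s := coherent_total (m i) sigma (gs s).
have W1 s : 1 <= \sum_(i < I) 2 * (W i s)%:R / ((gamma ^+ 2) ^+ p.+1) ^+ m i.
  have G0 i : 0 < ((gamma ^+ 2) ^+ p.+1) ^+ m i by rewrite !exprn_gt0.
  have nI0 : (0 < n0 + I * d)%N by rewrite addn_gt0 /n0 addn_gt0 (leq_trans d0 dD).
  have [i hi] := growth_step g1 d0 (multiplicity_le k (gs s) rho n0) hI (big s _ nI0).
  rewrite (bigD1 i)//= -[X in X <= _]addr0 lerD//; last first.
    by apply: sumr_ge0 => j _; rewrite divr_ge0 ?mulr_ge0// ltW.
  rewrite ler_pdivlMr// mul1r.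
  have step : (2 * p.+1 ^ 2 * D * multiplicity k (gs s) rho (n0 + i * d) <=
      multiplicity k (gs s) rho (m i))%N.
    by rewrite -(ler_nat R); apply: le_trans hi; rewrite natrM ler_wpM2r.
  have [c hc] := grid_nonrecurrent hk Lip'0 (gsL s) step.
  apply: (@le_trans _ _ ((multiplicity k (gs s) rho (m i) ^ p.+1)%N%:R)).
    rewrite natrX exprAC lerXn2r ?nnegrE ?exprn_ge0 ?(ltW g0)//.
    by rewrite ltW// big// addn_gt0 d0.
  rewrite -natrM ler_nat; apply: leq_trans hc _.
  by rewrite leq_mul2l /W /coherent_total (bigD1 c)//= leq_addr.
have W2 i : \sum_s (W i s)%:R <= (k%:R ^+ 2) ^+ m i * C ^+ p * T%:R ^+ L.
  apply: (coherent_tuples_le g _ (mI i) delta0 sigma0).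
  by rewrite addnA; apply: leq_trans Dn0 _; rewrite addnAC leq_addl.
have total : T%:R ^+ L <= \sum_(i < I) 2 * C ^+ p * T%:R ^+ L * 2^-1 ^+ m i :> R.
  rewrite [X in X <= _](_ : _ = \sum_(s : {ffun 'I_L -> 'I_T}) 1); last first.
    by rewrite sumr_const card_ffun !card_ord natrX.
  apply: (@le_trans _ _ (\sum_s \sum_(i < I)
      2 * (W i s)%:R / ((gamma ^+ 2) ^+ p.+1) ^+ m i)).
    by apply: ler_sum => s _; exact: W1.
  rewrite exchange_big /=; apply: ler_sum => i _.
  set G := _ ^+ m i.
  have G0 : 0 < G by rewrite !exprn_gt0.
  have kG : (k%:R ^+ 2) ^+ m i <= G * 2^-1 ^+ m i.
    by rewrite exprVn ler_pdivlMr ?exprn_gt0// mulrC -exprMn lerXn2r ?nnegrE ?mulr_ge0 ?exprn_ge0// ?ltW.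
  rewrite -mulr_suml -mulr_sumr ler_pdivrMr//.
  have h2 := W2 i.
  apply: (@le_trans _ _ (2 * ((k%:R ^+ 2) ^+ m i * C ^+ p * T%:R ^+ L))).
    by rewrite ler_wpM2l.
  have -> : 2 * C ^+ p * T%:R ^+ L * 2^-1 ^+ m i * G = 2 * (G * 2^-1 ^+ m i * C ^+ p * T%:R ^+ L) by ring.
  by rewrite ler_wpM2l// ler_wpM2r ?exprn_ge0 ?(ltW T0')// ler_wpM2r ?exprn_ge0.
have half : \sum_(i < I) (2^-1 : R) ^+ m i <= 2^-1 ^+ n0.
  apply: (@le_trans _ _ (\sum_(i < I) 2^-1 ^+ n0 * 2^-1 ^+ i.+1)).
    apply: ler_sum => i _; rewrite -exprD ler_wiXn2l//; first lra.
    rewrite /m addnCA leq_add2l -mulSn; exact: leq_pmulr.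
  rewrite -mulr_sumr -[X in _ <= X]mulr1 ler_wpM2l ?exprn_ge0//.
  exact: sum_half_powers.
move: total; rewrite -mulr_sumr; apply/negP; rewrite -ltNge.
have TL : 0 < T%:R ^+ L :> R by rewrite exprn_gt0.
apply: (@le_lt_trans _ _ (2 * C ^+ p * T%:R ^+ L * 2^-1 ^+ n0)).
  by rewrite ler_wpM2l// !mulr_ge0 ?exprn_ge0 ?(ltW T0').
rewrite exprVn mulrAC -[X in _ < X]mul1r ltr_pM2r//.
by rewrite ltr_pdivrMr ?exprn_gt0// mul1r.
Qed.
End Perturbation.

(** * Trigonometric bumps *)

Section Trigonometric.
Variable R : realType.
Implicit Types (f g : R -> R).

Lemma derivable_lipschitz f (C : R) :
  (forall x, derivable f x 1) -> (forall x, `|f^`() x| <= C) ->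
  forall u v, `|f u - f v| <= C * `|u - v|.
Proof.
move=> df fC.
have main u v : u < v -> `|f v - f u| <= C * `|v - u|.
  move=> uv; have [||c _ ->] := @MVT R f (f^`()) u v uv.
  - by move=> x _; rewrite derive1E; exact: derivableP.
  - by apply: derivable_within_continuous => x _; exact: df.
  - by rewrite normrM ler_wpM2r.
move=> u v; have [uv|vu|->] := ltgtP u v; last by rewrite !subrr normr0 mulr0.
- by rewrite distrC [`|u - v|]distrC; exact: main.
- exact: main.
Qed.

Lemma cos_periodZ (n : int) x : cos (x + 2 * pi * n%:~R) = cos x :> R.
Proof.
have N (m : nat) y : cos (y + 2 * pi * m%:R) = cos y :> R.
  have E : y + 2 * pi * m%:R = y + pi *+ 2 *+ m by rewrite -[pi *+ 2 *+ m]mulr_natr -[pi *+ 2]mulr_natr; ring.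
  by rewrite E; exact: (periodicn (@cosD2pi R)).
case: n => m; first exact: N.
by rewrite NegzE mulrNz mulrN -[LHS](N m.+1) subrK.
Qed.

(** Trigonometric polynomials with phases. The phases make the class stable under
    differentiation and translation without sines. *)
Inductive trig_poly : (R -> R) -> Prop :=
| TrigCos a (n : int) c : trig_poly (fun x => a * cos (2 * pi * n%:~R * x + c))
| TrigAdd f g : trig_poly f -> trig_poly g -> trig_poly (fun x => f x + g x).

Let harm_derive (a w c x : R) :
  is_derive x 1 (fun x => a * cos (w * x + c)) (a * w * cos (w * x + (c + pi / 2))).
Proof.
have h1 : is_derive x (1 : R) (fun x : R => w * x + c) w.
  rewrite (_ : (fun x => _) = (w \*: (@id R)) \+ cst c); last exact/funext.
  by apply: is_derive_eq; rewrite addr0 [LHS]mulr1.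
have h2 : is_derive x (1 : R) (cos \o (fun x : R => w * x + c)) (- sin (w * x + c) * w).
  exact: is_derive1_comp.
have h3 : is_derive x (1 : R) (fun x : R => a * cos (w * x + c)) (a *: (- sin (w * x + c) * w)).
  exact: (is_deriveZ _ h2).
apply: (is_derive_eq h3); rewrite addrA cosDpihalf.
by rewrite -[LHS]/(a * (- sin (w * x + c) * w)); ring.
Qed.

Let harm_derive1 (a w c x : R) :
  (fun x => a * cos (w * x + c))^`() x = a * w * cos (w * x + (c + pi / 2)).
Proof. by rewrite derive1E; apply: derive_val; exact: harm_derive. Qed.

Lemma trig_periodic f : trig_poly f -> periodic f 1.
Proof.
elim=> [a n c|{}f g _ IHf _ IHg] x /=; last by rewrite IHf IHg.
by rewrite mulrDr mulr1 addrAC cos_periodZ.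
Qed.

Lemma trig_derive f : trig_poly f ->
  (forall x, derivable f x 1) /\ trig_poly (f^`()).
Proof.
elim=> [a n c|{}f g _ [df tf] _ [dg tg]].
  split=> [x|]; first by have [] := harm_derive a (2 * pi * n%:~R) c x.
  rewrite (_ : _^`() = fun x => a * (2 * pi * n%:~R) * cos (2 * pi * n%:~R * x + (c + pi / 2))).
    exact: TrigCos.
  by apply/funext => x; exact: harm_derive1.
split=> [x|]; first exact: derivableD.
rewrite (_ : _^`() = fun x => derive1 f x + derive1 g x); first exact: TrigAdd.
by apply/funext => x; rewrite !derive1E deriveD.
Qed.

Lemma trig_derive1n f j : trig_poly f -> trig_poly (f^`(j)).
Proof. by move=> tf; elim: j => //= j IH; exact: (trig_derive IH).2. Qed.

Lemma trig_bounded f : trig_poly f -> exists C, forall x, `|f x| <= C.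
Proof.
elim=> [a n c|{}f g _ [C hC] _ [C' hC']].
  by exists `|a| => x; rewrite normrM ler_piMr// cos_max.
by exists (C + C') => x; apply: le_trans (ler_normD _ _) _; rewrite lerD.
Qed.

Lemma trig_lipschitz f : trig_poly f ->
  exists2 C, 0 <= C & forall u v, `|f u - f v| <= C * `|u - v|.
Proof.
move=> tf; have [df tdf] := trig_derive tf; have [C hC] := trig_bounded tdf.
exists C; first exact: le_trans (hC 0).
exact: derivable_lipschitz.
Qed.

(** The primitive of a periodic function is periodic only after its mean [c] has
    been removed. *)
Lemma trig_primitive f : trig_poly f ->
  exists F c, trig_poly F /\ forall x, F^`() x = f x - c.
Proof.
elim=> [a n c|{}f g _ [F [c [tF Ff]]] _ [G [c' [tG Gg]]]]; last first.
  exists (fun x => F x + G x), (c + c'); split; first exact: TrigAdd.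
  move=> x; have [dF _] := trig_derive tF; have [dG _] := trig_derive tG.
  by rewrite derive1E deriveD// -!derive1E Ff Gg; ring.
have [->|n0] := eqVneq n 0.
  exists (fun x => 0 * cos (2 * pi * 0%:~R * x + 0)), (a * cos c); split; first exact: TrigCos.
  move=> x; rewrite harm_derive1.
  by rewrite mulr0 !mul0r add0r subrr.
set w := 2 * pi * n%:~R.
have w0 : w != 0 by rewrite !mulf_neq0 ?intr_eq0// gt_eqF// pi_gt0.
exists (fun x => a / w * cos (2 * pi * n%:~R * x + (c - pi / 2))), 0; split.
  exact: TrigCos.
move=> x; rewrite harm_derive1 -/w.
by rewrite subrK divfK// subr0.
Qed.

Lemma trig_mulcos f : trig_poly f -> trig_poly (fun x => f x * ((1 + cos (2 * pi * x)) / 2)).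
Proof.
elim=> [a n c|{}f g _ tf _ tg]; last first.
  rewrite (_ : (fun x => _) = fun x => f x * ((1 + cos (2 * pi * x)) / 2) + g x * ((1 + cos (2 * pi * x)) / 2)).
    exact: TrigAdd.
  by apply/funext => x; rewrite mulrDl.
rewrite (_ : (fun x => _) = fun x => a / 2 * cos (2 * pi * n%:~R * x + c) +
    (a / 4 * cos (2 * pi * (n + 1)%:~R * x + c) + a / 4 * cos (2 * pi * (n - 1)%:~R * x + c))).
  by apply: TrigAdd; [exact: TrigCos|apply: TrigAdd; exact: TrigCos].
apply/funext => x.
have -> : 2 * pi * (n + 1)%:~R * x + c = (2 * pi * n%:~R * x + c) + 2 * pi * x.
  by rewrite intrD; ring.
have -> : 2 * pi * (n - 1)%:~R * x + c = (2 * pi * n%:~R * x + c) - 2 * pi * x.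
  by rewrite intrB; ring.
by move: (_ + c) => A; rewrite cosD cosB; field.
Qed.

Lemma trig_shift f c : trig_poly f -> trig_poly (fun x => f (x - c)).
Proof.
elim=> [a n e|{}f g _ tf _ tg]; last exact: TrigAdd.
rewrite (_ : (fun x => _) = fun x => a * cos (2 * pi * n%:~R * x + (e - 2 * pi * n%:~R * c))).
  exact: TrigCos.
by apply/funext => x; congr (_ * cos _); ring.
Qed.

(** A nonnegative trigonometric polynomial that concentrates at the integers as
    [Q] grows. *)
Definition peak (Q : nat) (x : R) : R := ((1 + cos (2 * pi * x)) / 2) ^+ Q.

Lemma trig_peak Q : trig_poly (peak Q).
Proof.
elim: Q => [|Q IH].
  rewrite (_ : peak 0 = fun x => 1 * cos (2 * pi * 0%:~R * x + 0)); first exact: TrigCos.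
  by apply/funext => x; rewrite mulr0 mul0r addr0 cos0 mulr1 /peak expr0.
rewrite (_ : peak Q.+1 = fun x => peak Q x * ((1 + cos (2 * pi * x)) / 2)).
  exact: trig_mulcos.
by apply/funext => x; rewrite /peak exprSr.
Qed.

Lemma peak_range Q x : 0 <= peak Q x <= 1.
Proof.
have h : 0 <= (1 + cos (2 * pi * x)) / 2 <= 1.
  have := cos_geN1 (2 * pi * x); have := cos_le1 (2 * pi * x) => ? ?.
  by apply/andP; split; lra.
by case/andP: h => h0 h1; rewrite exprn_ge0//= exprn_ile1.
Qed.

Lemma cos_away (w u : R) : 0 <= w -> w <= `|u| <= 1 - w ->
  cos (2 * pi * u) <= cos (2 * pi * w).
Proof.
move=> w0 /andP[wu uw]; have pi0 := pi_gt0 R.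
have -> : cos (2 * pi * u) = cos (2 * pi * `|u|).
  have [u0|u0] := ger0P u; first by [].
  by rewrite mulrN cosN.
move: (normr_ge0 u) wu uw; move: `|u| => v v0 wv vw.
have dec (x y : R) : 0 <= x -> x <= y -> y <= 2^-1 -> cos (2 * pi * y) <= cos (2 * pi * x).
  move=> x0 xy y2; rewrite le_eqVlt; have [->|xy'] := eqVneq x y; first by rewrite eqxx.
  apply/orP; right; rewrite ltr_cos ?in_itv /=.
  - have lt : x < y by rewrite lt_neqAle xy' xy.
    by rewrite ltr_pM2l ?mulr_gt0.
  - by rewrite !mulr_ge0 ?(ltW pi0) ?(le_trans x0)//=; nra.
  - by rewrite !mulr_ge0 ?(ltW pi0)//=; nra.
have [v2|v2] := lerP v 2^-1; first exact: dec.
have -> : cos (2 * pi * v) = cos (2 * pi * (1 - v)) :> R.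
  rewrite -cosN -(cos_periodZ 1 (- _)); congr (cos _); ring.
by apply: dec => //; lra.
Qed.

Lemma peak_core Q : exists2 e, 0 < e & forall u, `|u| <= e -> 2^-1 <= peak Q u.
Proof.
have [C C0 hC] := trig_lipschitz (trig_peak Q).
exists (2 * (C + 1))^-1; first by rewrite invr_gt0 mulr_gt0// ltr_wpDl.
move=> u ue; have := hC u 0; rewrite subr0.
have -> : peak Q 0 = 1 by rewrite /peak mulr0 cos0 (_ : (1 + 1) / 2 = 1) ?expr1n//; field.
move=> h; have : C * `|u| <= 2^-1.
  apply: le_trans (ler_wpM2l C0 ue) _.
  by rewrite invfM mulrCA ler_piMr// ler_pdivrMr ?mul1r; lra.
by move: h; rewrite ler_norml => /andP[]; lra.
Qed.

(** Take [Q] so large that [peak Q] is below [k ^ - D] at distance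
    [k ^ - d / 4] from the integers, then [L] so large that [peak Q] is above 1/2
    at distance [1 / L], and use the translates by multiples of [1 / L]. *)
Lemma exists_bumps (k d D : nat) : (2 <= k)%N ->
  exists L Q, bump_family k d D (fun l : 'I_L => fun x => peak Q (x - l%:R / L%:R)).
Proof.
move=> hk; pose w : R := (2 * k%:R ^+ d)^-1.
have k0 n : 0 < k%:R ^+ n :> R by rewrite exprn_gt0// ltr0n; lia.
have w0 : 0 < w by rewrite invr_gt0 mulr_gt0.
have w2 : w <= 2^-1.
  rewrite lef_pV2 ?posrE ?mulr_gt0// ler_peMr// exprn_ege1// ler1n; lia.
have pi0 := pi_gt0 R.
pose q : R := (1 + cos (2 * pi * (w / 2))) / 2.
have q1 : q < 1.
  suff : cos (2 * pi * (w / 2)) < cos 0 :> R by rewrite cos0 /q; lra.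
  by rewrite ltr_cos ?in_itv /= ?lexx ?(ltW pi0) ?mulr_gt0 ?divr_gt0 //= ?mulr_ge0 ?divr_ge0 ?(ltW w0)//=; nra.
have q0 : 0 < q.
  suff : cos pi < cos (2 * pi * (w / 2)) :> R by rewrite cospi /q; lra.
  by rewrite ltr_cos ?in_itv /= ?lexx ?(ltW pi0) ?mulr_ge0 ?divr_ge0 ?(ltW w0)//=; nra.
have [Q hQ] : exists Q, k%:R ^+ D <= q^-1 ^+ Q by apply: expr_unbounded; rewrite invf_gt1.
have [e e0 he] := peak_core Q.
pose e' := Num.min e (w / 2).
have e'0 : 0 < e' by rewrite lt_min e0 divr_gt0.
pose L := (Num.truncn e'^-1).+1.
have L0 : 0 < L%:R :> R by rewrite ltr0n.
have Le : L%:R^-1 <= e'.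
  by rewrite -[e']invrK lef_pV2 ?posrE ?invr_gt0//; exact/ltW/truncnS_gt.
exists L, Q; split=> [l x|x /andP[x0 x1]]; first exact: peak_range.
have xL0 : 0 <= x * L%:R by rewrite mulr_ge0 ?ler0n.
have /andP[c1 c2] := truncn_itv xL0; set c := Num.truncn _ in c1 c2.
have cL : (c < L)%N.
  by rewrite -(ltr_nat R); apply: le_lt_trans c1 _; rewrite -[X in _ < X]mul1r ltr_pM2r.
have xc : 0 <= x - c%:R / L%:R <= e'.
  have E : x - c%:R / L%:R = (x * L%:R - c%:R) / L%:R by field; rewrite gt_eqF.
  rewrite E divr_ge0 ?subr_ge0 ?ler0n//=; apply: le_trans Le.
  by rewrite -[X in _ <= X]mul1r ler_wpM2r ?invr_ge0//; move: c2; rewrite -natr1; lra.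
have [ee ew] : e' <= e /\ e' <= w / 2 by rewrite !ge_min !lexx orbT.
case/andP: xc => xc0 xc1.
exists (Ordinal cL); split=> /= [|z _ /andP[f1 f2]].
  by apply: he; rewrite ger0_norm//; exact: le_trans ee.
rewrite -[X in _ <= X]invrK ?invrK; apply: (@le_trans _ _ (q ^+ Q)); last first.
  rewrite exprVn in hQ.
  by rewrite -[X in X <= _]invrK lef_pV2 ?posrE ?invr_gt0 ?(exprn_gt0 _ q0) ?k0.
suff h : (1 + cos (2 * pi * (z - c%:R / L%:R))) / 2 <= q.
  by rewrite /peak lerXn2r// ?nnegrE ?(ltW q0)// divr_ge0// -lerBlDl sub0r cos_geN1.
suff : cos (2 * pi * (z - c%:R / L%:R)) <= cos (2 * pi * (w / 2)) by rewrite /q; lra.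
apply: cos_away; first by rewrite divr_ge0 ?(ltW w0).
move: f1 f2; rewrite -/w; set b := c%:R / L%:R in xc0 xc1 *.
have [P1|P1] := ger0P (x - z); have [P2|P2] := ger0P (z - b) => f1 f2; apply/andP; split; lra.
Qed.

End Trigonometric.

(** * Neighbourhoods in the C^m topology *)

Section CmTopology.
Variables (R : realType) (m : option nat).
Implicit Types (f tau : Cm_circle R m).

Definition Cm_ball tau (J : nat) (e : R) : set (Cm_circle R m) :=
  [set f | forall j, (j <= J)%N -> le_order j m -> forall x, `|derive1n j f x - derive1n j tau x| < e].

Definition Cm_ball_filter tau : set_system (Cm_circle R m) :=
  filter_from [set p : nat * R | 0 < p.2] (fun p => Cm_ball tau p.1 p.2).

Lemma Cm_ball_filterP tau : Filter (Cm_ball_filter tau).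
Proof.
apply: filter_from_filter; first by exists (0%N, 1) => /=.
move=> [J e] [J' e'] /= e0 e'0; exists (maxn J J', Num.min e e'); first by rewrite /= lt_min e0.
move=> f /= hf; split=> j jJ jm x; have := hf j _ jm x; rewrite lt_min => /(_ _)/andP h.
- by apply: (h _).1; rewrite leq_max jJ.
- by apply: (h _).2; rewrite leq_max jJ orbT.
Qed.

(** Convergence to [tau] in the C^m topology is uniform convergence of each
    derivative separately, and for each of them some [Cm_ball] suffices. *)
Lemma Cm_ball_cvg tau : Cm_ball_filter tau --> tau.
Proof.
have FF := Cm_ball_filterP tau.
have : (@Cm_jet R m) @ Cm_ball_filter tau --> (@Cm_jet R m tau).
  apply/cvg_sup => i A [_ [[W oW <-] Wt] WA].
  have /uniform_nbhs[E [entE EW]] : nbhs (Cm_jet tau i) W by exact: open_nbhs_nbhs.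
  have [e e0 eE] : exists2 e : R, 0 < e & forall a b, `|b - a| < e -> E (a, b).
    have := entE; rewrite -entourage_ballE => -[e /= e0 eE]; exists e => // a b ab.
    by apply: eE => /=; rewrite -ball_normE /ball_ /= distrC.
  rewrite /nbhs /=; exists (i, e) => // f /= hf; apply: WA => /=; apply: EW => /= x _.
  apply: eE; rewrite /Cm_jet; case: ifPn => [im|_]; last by rewrite subrr normr0.
  exact: hf.
move=> jc U [_ [[B oB <-] Bt] BU].
have : nbhs (@Cm_jet R m tau) B by exact: open_nbhs_nbhs.
by move=> /jc h; apply: (@filterS _ (Cm_ball_filter tau) FF (@Cm_jet R m @^-1` B)).
Qed.

Lemma nbhs_Cm_ball tau (U : set (Cm_circle R m)) : nbhs tau U ->
  exists J e, 0 < e /\ Cm_ball tau J e `<=` U.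
Proof. by move=> /Cm_ball_cvg[[J e] /= e0 h]; exists J, e. Qed.

Lemma nbhs_derive1 tau (e : R) : le_order 1 m -> 0 < e ->
  nbhs tau [set f | forall x, `|derive1 f x - derive1 tau x| < e].
Proof.
move=> m1 e0.
have c1 : continuous (@Cm_jet R m) by exact: initial_continuous.
have c2 := @proj_continuous nat (fun=> {uniform R -> R}) 1%N (Cm_jet tau).
have : nbhs (Cm_jet tau 1%N) [set h : {uniform R -> R} | forall x, `|h x - derive1 tau x| < e].
  apply/uniform_nbhs; exists [set ab | `|ab.2 - ab.1| < e]; split.
    rewrite -entourage_ballE; exists e => //= -[a b] /=.
    by rewrite /ball_ /= distrC.
  by move=> h /= hh x; have := hh x I; rewrite /Cm_jet m1.
move=> /c2 h2; have h3 := c1 tau _ h2.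
apply: (@filterS _ (nbhs tau) (nbhs_filter tau) _ _ _ h3) => f /= hf x.
by have := hf x; rewrite /proj /Cm_jet m1.
Qed.

End CmTopology.

(** * Completeness of C^m *)

Section Completeness.
Variable R : realType.

(** The intervals of centre [u i] and radius [eta i / 2] are nested, so the
    supremum of their left ends belongs to all of them. *)
Lemma nested_limit (u eta : nat -> R) (i0 : nat) :
  (forall i, 0 <= eta i) -> (forall i, eta i.+1 <= eta i / 2) ->
  (forall i, (i0 <= i)%N -> `|u i.+1 - u i| <= eta i / 4) ->
  exists s, forall i, (i0 <= i)%N -> `|s - u i| <= eta i / 2.
Proof.
move=> eta0 etaS hu.
pose lo n := u (i0 + n)%N - eta (i0 + n)%N / 2.
pose hi n := u (i0 + n)%N + eta (i0 + n)%N / 2.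
have step n : lo n <= lo n.+1 /\ hi n.+1 <= hi n.
  rewrite /lo /hi addnS; have := hu (i0 + n)%N (leq_addr _ _).
  have := etaS (i0 + n)%N; rewrite ler_norml => e /andP[? ?].
  by split; lra.
have loM n k : lo n <= lo (n + k)%N.
  elim: k => [|k IH]; first by rewrite addn0.
  by rewrite addnS; apply: le_trans IH (step _).1.
have hiM n k : hi (n + k)%N <= hi n.
  elim: k => [|k IH]; first by rewrite addn0.
  by rewrite addnS; apply: le_trans (step _).2 IH.
have lohi n n' : lo n <= hi n'.
  apply: le_trans (loM n n') _; rewrite addnC; apply: le_trans (hiM n' n).
  by rewrite /lo /hi; have := eta0 (i0 + (n' + n))%N; lra.
exists (sup (range lo)) => i i0i.
have [n ->] : exists n, i = (i0 + n)%N by exists (i - i0)%N; rewrite subnKC.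
have h1 : lo n <= sup (range lo).
  apply: ub_le_sup; last by exists n.
  by exists (hi 0%N) => _ [n' _ <-]; exact: lohi.
have h2 : sup (range lo) <= hi n.
  by apply: ge_sup => [|_ [n' _ <-]]; [exists (lo 0%N); exists 0%N|exact: lohi].
by move: h1 h2; rewrite /lo /hi ler_norml => ? ?; apply/andP; split; lra.
Qed.

Lemma geometric_small (eta : nat -> R) (i0 : nat) (e : R) :
  (forall i, eta i.+1 <= eta i / 2) -> 0 < e ->
  exists i, (i0 <= i)%N /\ eta i < e.
Proof.
move=> etaS e0.
have bound i : eta i <= eta 0%N / 2 ^+ i.
  elim: i => [|i IH]; first by rewrite expr0 divr1.
  apply: le_trans (etaS i) _; rewrite exprS invfM.
  have -> : eta 0%N * (2^-1 * (2 ^+ i)^-1) = eta 0%N / 2 ^+ i / 2 by ring.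
  by rewrite ler_wpM2r.
have [n hn] := expr_unbounded ((`|eta 0%N| + 1) / e) (ltr1n R 2).
exists (i0 + n)%N; split; first exact: leq_addr.
apply: le_lt_trans (bound _) _.
have p0 : 0 < 2 ^+ (i0 + n) :> R by rewrite exprn_gt0.
rewrite ltr_pdivrMr//.
have le1 : 2 ^+ n <= 2 ^+ (i0 + n) :> R by rewrite ler_weXn2l ?leq_addl//; lra.
have := le_trans hn le1; rewrite ler_pdivrMr// mulrC => h.
by apply: lt_le_trans h; have := ler_norm (eta 0%N); lra.
Qed.

(** The mean value inequality for [h i' - h i], with [i'] going to infinity, shows
    that [g - h i] has Lipschitz constant [2 * eta i]. Hence the difference
    quotients of [g] and of [h i] differ by at most [2 * eta i]. *)
Lemma is_derive_limit (h h' : nat -> R -> R) (g g' : R -> R) (eta : nat -> R) (i0 : nat) (x : R) :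
  (forall i, eta i.+1 <= eta i / 2) -> (forall i, 0 <= eta i) ->
  (forall i, (i0 <= i)%N -> forall x, is_derive x (1 : R) (h i) (h' i x)) ->
  (forall i, (i0 <= i)%N -> forall x, `|g x - h i x| <= eta i) ->
  (forall i, (i0 <= i)%N -> forall x, `|g' x - h' i x| <= eta i) ->
  is_derive x (1 : R) g (g' x).
Proof.
move=> etaS eta0 dh gh gh'.
have anti i i' : (i <= i')%N -> eta i' <= eta i.
  elim: i' => [|i' IH]; first by rewrite leqn0 => /eqP ->.
  rewrite leq_eqVlt ltnS => /predU1P[->//|/IH]; have := etaS i'; have := eta0 i'.
  by lra.
have rem i y : (i0 <= i)%N ->
    `|(g (x + y) - h i (x + y)) - (g x - h i x)| <= 2 * eta i * `|y|.
  move=> ii0; apply/ler_addgt0Pr => e e0.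
  have e4 : 0 < e / 4 by rewrite divr_gt0.
  have [i' [ii' ei']] := geometric_small i etaS e4.
  have i'0 : (i0 <= i')%N by apply: leq_trans ii'.
  have := gh _ i'0 (x + y); have := gh _ i'0 x.
  have : `|(h i' (x + y) - h i (x + y)) - (h i' x - h i x)| <= 2 * eta i * `|y|.
    have dd (z : R) : is_derive z (1 : R) (fun z : R => h i' z - h i z) (h' i' z - h' i z).
      by apply: is_deriveB; exact: dh.
    have := @derivable_lipschitz R (fun z : R => h i' z - h i z) (2 * eta i) _ _ (x + y) x.
    rewrite [x + y - x]addrAC subrr add0r; apply.
      by move=> z; have [] := dd z.
    move=> z; rewrite derive1E (@derive_val _ _ _ _ _ _ _ (dd z)).
    have := gh' _ ii0 z; have := gh' _ i'0 z; have := anti _ _ ii'.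
    rewrite !ler_norml => ? /andP[? ?] /andP[? ?]; apply/andP; split; lra.
  move: ei'; rewrite !ler_norml => ? /andP[? ?] /andP[? ?] /andP[? ?].
  by apply/andP; split; lra.
have lim : (fun t : R => t^-1 *: ((g \o shift x) (t *: (1 : R)) - g x)) @ 0^' --> g' x.
  apply/cvgrPdist_lt => e e0.
  have e4 : 0 < e / 4 by rewrite divr_gt0.
  have [i [ii0 ei]] := geometric_small i0 etaS e4.
  have [di vi] := dh i ii0 x.
  have : (fun t : R => t^-1 *: ((h i \o shift x) (t *: (1 : R)) - h i x)) @ 0^' --> h' i x.
    by rewrite -vi; exact: di.
  move/cvgrPdist_lt => /(_ _ e4) near_i.
  near=> t.
  have t0 : t != 0 by near: t; exact: nbhs_dnbhs_neq.
  have : `|h' i x - t^-1 *: ((h i \o shift x) (t *: (1 : R)) - h i x)| < e / 4 by near: t.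
  rewrite /= -![_ *: _]/(_ * _) mulr1 => ht.
  have := rem i t ii0; rewrite [x + t]addrC => ht2.
  have : `|t^-1 * (g (t + x) - g x) - t^-1 * (h i (t + x) - h i x)| <= 2 * eta i.
    rewrite -mulrBr normrM normfV mulrC ler_pdivrMr ?normr_gt0//.
    by move: ht2; congr (`|_| <= _); ring.
  have := gh' i ii0 x; move: ht.
  rewrite !ltr_norml !ler_norml => /andP[? ?] /andP[? ?] /andP[? ?].
  by apply/andP; split; lra.
by apply: DeriveDef; [apply/cvg_ex; exists (g' x)|exact: cvg_lim].
Unshelve. all: by end_near. Qed.

Lemma continuous_limit (h : nat -> R -> R) (g : R -> R) (eta : nat -> R) (i0 : nat) :
  (forall i, eta i.+1 <= eta i / 2) ->
  (forall i, (i0 <= i)%N -> continuous (h i)) ->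
  (forall i, (i0 <= i)%N -> forall x, `|g x - h i x| <= eta i) ->
  continuous g.
Proof.
move=> etaS ch gh x; apply/cvgrPdist_lt => e e0.
have e3 : 0 < e / 3 by rewrite divr_gt0.
have [i [ii0 ei]] := geometric_small i0 etaS e3.
have /cvgrPdist_lt/(_ _ e3) := ch i ii0 x.
apply: filterS => y; have := gh i ii0 x; have := gh i ii0 y.
rewrite !ltr_norml !ler_norml => /andP[? ?] /andP[? ?] /andP[? ?].
by apply/andP; split; lra.
Qed.

(** The derivatives of each order converge uniformly. The limit of those of order
    [j + 1] is the derivative of the limit of those of order [j]. Each step
    controls finitely many orders only, so that the case of infinite [m] is
    included. *)
Lemma Cm_limit (m : option nat) (f : nat -> Cm_circle R m) (J : nat -> nat) (eta : nat -> R) :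
  (forall i, 0 <= eta i) -> (forall i, eta i.+1 <= eta i / 2) ->
  (forall i, i <= J i)%N -> (forall i, J i <= J i.+1)%N ->
  (forall i j, (j <= J i)%N -> le_order j m ->
     forall x, `|derive1n j (f i.+1) x - derive1n j (f i) x| <= eta i / 4) ->
  exists g : Cm_circle R m, forall i j, (j <= J i)%N -> le_order j m ->
     forall x, `|derive1n j g x - derive1n j (f i) x| <= eta i / 2.
Proof.
move=> eta0 etaS iJ JS hf.
have Jmono i i' : (i <= i')%N -> (J i <= J i')%N.
  elim: i' => [|i' IH]; first by rewrite leqn0 => /eqP ->.
  by rewrite leq_eqVlt ltnS => /predU1P[->//|/IH h]; apply: leq_trans h (JS _).
have ex j x : exists s, le_order j m -> forall i, (j <= J i)%N ->
    `|s - derive1n j (f i) x| <= eta i / 2.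
  have [jm|//] := boolP (le_order j m); last by exists 0.
  have exi : exists i, (j <= J i)%N by exists j.
  have [i0 ji0 min] := ex_minnP exi.
  have [s hs] := @nested_limit (fun i => derive1n j (f i) x) eta i0 eta0 etaS
    (fun i i0i => hf i j (leq_trans ji0 (Jmono _ _ i0i)) jm x).
  by exists s => _ i ji; apply: hs; exact: min.
have [g gP] : exists g : nat -> R -> R, forall j x i, le_order j m -> (j <= J i)%N ->
    `|g j x - derive1n j (f i) x| <= eta i / 2.
  exists (fun j x => projT1 (cid (ex j x))) => j x i jm ji.
  exact: (projT2 (cid (ex j x))).
have gP' j i : le_order j m -> (j <= i)%N -> forall x, `|g j x - derive1n j (f i) x| <= eta i.
  move=> jm ji x; apply: le_trans (gP j x i jm (leq_trans ji (iJ i))) _.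
  by have := eta0 i; lra.
have leS j : le_order j.+1 m -> le_order j m by rewrite /le_order; case: (m) => // r /ltnW.
have gder j x : le_order j.+1 m -> is_derive x (1 : R) (g j) (g j.+1 x).
  move=> jm; apply: (@is_derive_limit (fun i => derive1n j (f i)) (fun i => derive1n j.+1 (f i)) (g j) (g j.+1) eta j.+1) => //.
  - move=> i ij y; have [_ dfi _] := Cm_funP (f i).
    by apply: DeriveDef; [exact: dfi|rewrite derive1nS derive1E].
  - by move=> i ij y; apply: gP'; [exact: leS|exact: ltnW].
  - by move=> i ij y; apply: gP'.
have gn j : le_order j m -> derive1n j (g 0%N) = g j.
  elim: j => [|j IH] jm; first by rewrite derive1n0.
  rewrite derive1nS (IH (leS _ jm)).
  apply/funext => x; rewrite derive1E; exact: (@derive_val _ _ _ _ _ _ _ (gder j x jm)).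
have gC : is_Cm_circle m (g 0%N).
  split.
  - move=> x; apply/eqP; rewrite -subr_eq0 -normr_le0; apply/ler_addgt0Pr => e e0.
    have [i [_ ei]] := geometric_small 0 etaS e0.
    have m0 : le_order 0 m by case: (m).
    have := gP 0%N (x + 1) i m0 (leq0n _); have := gP 0%N x i m0 (leq0n _).
    have [pf _ _] := Cm_funP (f i).
    rewrite /= pf add0r !ler_norml => /andP[? ?] /andP[? ?].
    by apply/andP; split; lra.
  - by move=> j jm x; rewrite (gn _ (leS _ jm)); have [] := gder j x jm.
  - move=> j jm; rewrite (gn _ jm).
    apply: (@continuous_limit (fun i => derive1n j (f i)) (g j) eta j) => //.
      by move=> i _; have [_ _ cf] := Cm_funP (f i); exact: cf.
    by move=> i ji x; exact: gP'.
exists (MkCmCircle gC) => i j ji jm x /=.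
by rewrite (gn _ jm); exact: gP.
Qed.

End Completeness.

(** * Smooth periodic functions and their trigonometric perturbations *)

Section SmoothFunctions.
Variable R : realType.
Implicit Types (f g : R -> R).

Lemma derive1_translate f (a : R) : derive1 (fun x => f (x + a)) = fun x => derive1 f (x + a).
Proof.
apply/funext => x; rewrite /derive1.
have E : (fun h : R => h^-1 *: (f (h + x + a) - f (x + a))) =
    (fun h : R => h^-1 *: (f (h + (x + a)) - f (x + a))).
  by apply/funext => h; rewrite addrA.
by rewrite E.
Qed.

Lemma derive1n_translate f (a : R) j :
  derive1n j (fun x => f (x + a)) = fun x => derive1n j f (x + a).
Proof.
elim: j => [|j IH]; first by rewrite !derive1n0.
by rewrite !derive1nS IH derive1_translate.
Qed.

Lemma periodic_derive1n f j : periodic f (1 : R) -> periodic (derive1n j f) (1 : R).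
Proof.
move=> pf x; have := derive1n_translate f 1 j; rewrite (_ : (fun y => f (y + 1)) = f).
  by move=> /(congr1 (fun h => h x)) ->.
by apply/funext => y; rewrite pf.
Qed.

Lemma periodicZ f (n : int) x : periodic f (1 : R) -> f (x + n%:~R) = f x.
Proof.
move=> pf; have N (k : nat) y : f (y + k%:R) = f y by exact: (periodicn pf).
case: n => k; first exact: N.
by rewrite NegzE mulrNz -[LHS](N k.+1) subrK.
Qed.

(** Translate by the integer part to reduce to the compact interval [[0, 1]]. *)
Lemma periodic_bounded f : periodic f (1 : R) -> continuous f ->
  exists C, forall x, `|f x| <= C.
Proof.
move=> pf cf.
have cn : {within `[0, 1], continuous (fun x => `|f x|)}.
  apply: continuous_subspaceT => x; apply: continuous_comp; first exact: cf.
  exact: norm_continuous.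
have [c _ hc] := EVT_max ler01 cn.
exists `|f c| => x; rewrite -(periodicZ (- Num.floor x) x pf).
apply: hc; rewrite in_itv /= mulrNz.
have := Num.Theory.floor_le x; have := Num.Theory.floorD1_gt x.
by rewrite intrD => ? ?; apply/andP; split; lra.
Qed.

Lemma derive1n_add_trig m f g j : is_Cm_circle m f -> trig_poly g -> le_order j m ->
  derive1n j (fun x => f x + g x) = fun x => derive1n j f x + derive1n j g x.
Proof.
move=> [_ df _] tg; elim: j => [|j IH] jm; first by rewrite !derive1n0.
have jm' : le_order j m by move: jm; rewrite /le_order; case: (m) => // r /ltnW.
rewrite !derive1nS (IH jm'); apply/funext => x.
have [dg _] := trig_derive (trig_derive1n j tg).
by rewrite derive1E (@deriveD _ _ _ (derive1n j f) (derive1n j g)) ?derive1E//; exact: df.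
Qed.

Lemma is_Cm_add_trig m f g : is_Cm_circle m f -> trig_poly g ->
  is_Cm_circle m (fun x => f x + g x).
Proof.
move=> hf tg; have [pf df cf] := hf; split.
- by move=> x; rewrite pf trig_periodic.
- move=> j jm x; have jm' : le_order j m by move: jm; rewrite /le_order; case: (m) => // r /ltnW.
  rewrite (derive1n_add_trig hf tg jm'); apply: derivableD; first exact: df.
  by have [dg _] := trig_derive (trig_derive1n j tg); exact: dg.
- move=> j jm x; rewrite (derive1n_add_trig hf tg jm); apply: continuousD; first exact: cf.
  have [dg _] := trig_derive (trig_derive1n j tg).
  by apply: differentiable_continuous; apply/derivable1_diffP; exact: dg.
Qed.

Lemma trig_lincomb (I : finType) (h : I -> R -> R) (t : I -> R) :
  (forall i, trig_poly (h i)) -> trig_poly (fun x => \sum_i t i * h i x).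
Proof.
move=> th.
have t0 : trig_poly (fun _ : R => 0).
  rewrite (_ : (fun _ => 0) = fun x => 0 * cos (2 * pi * 0%:~R * x + 0)); first exact: TrigCos.
  by apply/funext => x; rewrite mul0r.
have tz c f : trig_poly f -> trig_poly (fun x => c * f x).
  elim=> [a n e|{}f g _ tf _ tg].
    rewrite (_ : (fun x => _) = fun x => c * a * cos (2 * pi * n%:~R * x + e)); first exact: TrigCos.
    by apply/funext => x; rewrite mulrA.
  rewrite (_ : (fun x => _) = fun x => c * f x + c * g x); first exact: TrigAdd.
  by apply/funext => x; rewrite mulrDr.
rewrite /index_enum; elim: Finite.enum => [|i s IH].
  by rewrite (_ : (fun x => _) = fun=> 0)//; apply/funext => x; rewrite big_nil.
rewrite (_ : (fun x => _) = fun x => t i * h i x + \sum_(j <- s) t j * h j x).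
  by apply: TrigAdd => //; exact: tz.
by apply/funext => x; rewrite big_cons.
Qed.

Lemma derive1n_lincomb (I : finType) (h : I -> R -> R) (t : I -> R) j :
  (forall i, trig_poly (h i)) ->
  derive1n j (fun x => \sum_i t i * h i x) = fun x => \sum_i t i * derive1n j (h i) x.
Proof.
move=> th; elim: j => [|j IH]; first by rewrite !derive1n0.
rewrite derive1nS IH; apply/funext => x; rewrite derive1E.
have d (s : seq I) : is_derive x (1 : R) (fun x : R => \sum_(i <- s) t i * derive1n j (h i) x)
    (\sum_(i <- s) t i * derive1n j.+1 (h i) x).
  elim: s => [|i s IHs].
    rewrite (_ : (fun x => _) = cst 0) ?big_nil; first exact: is_derive_cst.
    by apply/funext => y; rewrite big_nil.
  rewrite (_ : (fun x => _) = (fun x => t i * derive1n j (h i) x) \+ (fun x => \sum_(i <- s) t i * derive1n j (h i) x)).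
    rewrite big_cons; apply: is_deriveD.
    have [dh _] := trig_derive (trig_derive1n j (th i)).
    have dhi : is_derive x (1 : R) (derive1n j (h i)) (derive1n j.+1 (h i) x).
      by apply: DeriveDef; [exact: dh|rewrite derive1nS derive1E].
    exact: (is_deriveZ (t i) dhi).
  by apply/funext => y; rewrite big_cons.
exact: (@derive_val _ _ _ _ _ _ _ (d _)).
Qed.

Lemma trig_derivatives_bounded g J : trig_poly g ->
  exists2 C, 0 <= C & forall j x, (j <= J)%N -> `|derive1n j g x| <= C.
Proof.
move=> tg; elim: J => [|J [C C0 hC]].
  have [C hC] := trig_bounded (trig_derive1n 0 tg).
  exists C => [|j x]; first exact: le_trans (hC 0).
  by rewrite leqn0 => /eqP ->.
have [C' hC'] := trig_bounded (trig_derive1n J.+1 tg).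
have C'0 : 0 <= C' by apply: le_trans (hC' 0).
exists (C + C') => [|j x]; first exact: addr_ge0.
rewrite leq_eqVlt => /predU1P[->|jJ].
  by apply: le_trans (hC' x) _; rewrite lerDr.
by apply: le_trans (hC j x jJ) _; rewrite lerDl.
Qed.

Lemma Cm_derive1_lipschitz m (tau : Cm_circle R m) : le_order 3 m ->
  exists M Lip, [/\ 0 <= M, 0 <= Lip, forall x, `|derive1 tau x| <= M &
    forall u v, `|derive1 tau u - derive1 tau v| <= Lip * `|u - v|].
Proof.
move=> m3; have [pt dt ct] := Cm_funP tau.
have m2 : le_order 2 m by move: m3; rewrite /le_order; case: (m) => // r /ltnW.
have m1 : le_order 1 m by move: m2; rewrite /le_order; case: (m) => // r /ltnW.
have [M hM] := periodic_bounded (periodic_derive1n 1 pt) (ct 1%N m1).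
have [C hC] := periodic_bounded (periodic_derive1n 2 pt) (ct 2%N m2).
exists M, C; split; [exact: le_trans (hM 0)|exact: le_trans (hC 0)|exact: hM|].
by apply: derivable_lipschitz; [exact: (dt 1%N m2)|exact: hC].
Qed.

End SmoothFunctions.

(** * Captivity up to an exponential rate *)

Section Captivity.
Variables (R : realType) (k : nat).
Hypothesis hk : (2 <= k)%N.
Implicit Types (tau g h : R -> R) (eps rho r M : R).

Let k0 : (0 : R) < k%:R. Proof. by rewrite ltr0n; lia. Qed.
Let kn0 : k%:R != 0 :> R. Proof. by rewrite gt_eqF. Qed.
Let kX (n : nat) : 0 < k%:R ^+ n :> R. Proof. by rewrite exprn_gt0. Qed.

Lemma multiplicity_le_of_trap g h rho rho' n :
  (forall y zeta, 0 <= y < 1 -> exists zeta', trap k g rho n y zeta \subset trap k h rho' n y zeta') ->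
  (multiplicity k g rho n <= multiplicity k h rho' n)%N.
Proof.
move=> sub; have [y [zeta [y01 <-]]] := multiplicity_attained k g rho n.
have [zeta' s] := sub y zeta y01.
by apply: leq_trans (subset_leq_card s) _; exact: trap_le.
Qed.

Lemma multiplicity_perturb g h C rho rho' n : (forall x, `|g x - h x| <= C) ->
  k%:R ^+ n * C + rho <= rho' ->
  (multiplicity k g rho n <= multiplicity k h rho' n)%N.
Proof.
move=> gh hrho; apply: multiplicity_le_of_trap => // y zeta _; exists zeta.
apply/fintype.subsetP => a; rewrite !inE => ta.
have := momentum_diff hk y a gh; rewrite size_tuple; move: ta.
rewrite !ler_norml => /andP[? ?] /andP[? ?]; apply/andP; split; lra.
Qed.

Lemma multiplicity_addcst g (c : R) rho (n : nat) :
  (multiplicity k (fun x => g x + c)%R rho n <= multiplicity k g rho n)%N.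
Proof.
apply: multiplicity_le_of_trap => // y zeta _.
exists (zeta - \sum_(i < n) k%:R ^+ (n - i.+1) * c).
apply/fintype.subsetP => a; rewrite !inE /momentum size_tuple.
under eq_bigr do rewrite mulrDr.
by rewrite big_split /=; congr (`|_| <= _); ring.
Qed.

(** By submultiplicativity one length [n] controls the growth rate of the
    multiplicity. The strict inequality [M < rho] leaves the room needed for
    openness. *)
Definition eps_captive eps tau := exists n M rho, [/\ (0 < n)%N,
  forall x, `|derive1 tau x| <= M, M < rho &
  (multiplicity k (derive1 tau) rho n)%:R <= expR eps ^+ n].

(** A C^1-small change of [tau] moves momenta of order [n] by at most
    [k ^ n * delta], which is absorbed by shrinking the radius [rho]. *)
Lemma eps_captive_open eps tau : eps_captive eps tau ->
  exists2 delta, 0 < delta & forall sigma : R -> R,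
    (forall x, `|derive1 sigma x - derive1 tau x| < delta) -> eps_captive eps sigma.
Proof.
move=> [n [M [rho [n0 tM Mrho hn]]]].
have K1 : 0 < k%:R ^+ n + 1 :> R by rewrite addr_gt0.
pose delta := (rho - M) / (2 * (k%:R ^+ n + 1)).
have d0 : 0 < delta by rewrite divr_gt0 ?subr_gt0 ?mulr_gt0.
have dE : (k%:R ^+ n + 1) * delta = (rho - M) / 2 by rewrite /delta; field; rewrite gt_eqF.
exists delta => // sigma hs; exists n, (M + delta), (rho - k%:R ^+ n * delta); split=> //.
- move=> x; have := hs x; have := tM x; rewrite ltr_norml !ler_norml.
  by move=> /andP[? ?] /andP[? ?]; apply/andP; split; lra.
- by move: dE; rewrite mulrDl mul1r; lra.
- apply: le_trans hn; rewrite ler_nat; apply: (multiplicity_perturb (C := delta)).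
    by move=> x; exact: ltW.
  lra.
Qed.

Lemma multiplicity_pow g M rho (n q s : nat) : (forall x, `|g x| <= M) -> M <= rho ->
  (multiplicity k g rho (q * n + s) <= multiplicity k g rho n ^ q * k ^ s)%N.
Proof.
move=> gM Mrho; elim: q => [|q IH]; first by rewrite mul0n add0n mul1n multiplicity_le.
rewrite mulSn -addnA expnS -mulnA; apply: leq_trans (multiplicityD hk _ _ gM Mrho) _.
by rewrite leq_mul2l IH orbT.
Qed.

(** A zone of radius [r] is covered by about [r / rho] intervals of radius
    [rho]. *)
Lemma trapped_max_le tau rho r n : 0 < rho ->
  (trapped_max k tau r n <=
     (Num.truncn (r / rho)).+1 * multiplicity k (derive1 tau) rho n)%N.
Proof.
move=> rho0; apply/bigmax_leqP => c /asboolP[[y eta] /= [/= y01 _] <-].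
set A := (Num.truncn (r / rho)).+1.
pose z (i : 'I_A) : R := rho - r + 2 * rho * i%:R - k%:R ^+ n * eta.
apply: (@leq_trans #|\bigcup_i trap k (derive1 tau) rho n y (z i)|%SET).
  apply: subset_leq_card; apply/fintype.subsetP => a; rewrite inE.
  rewrite /cotangent_word (cotangent_wordE _ _ _ (fun x => erefl (derive1 tau x))) size_tuple.
  rewrite inE => -[_ /=]; set u := _ + _ => /andP[u1 u2].
  have r0 : 0 <= r by lra.
  have v0 : 0 <= (u + r) / (2 * rho) by rewrite divr_ge0 ?mulr_ge0 ?(ltW rho0)//; lra.
  have /andP[i1 i2] := truncn_itv v0; set i := Num.truncn _ in i1 i2.
  have iA : (i < A)%N.
    rewrite ltnS; apply: le_truncn.
    rewrite ler_pdivrMr ?mulr_gt0// mulrCA divfK ?gt_eqF//; lra.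
  apply/finset.bigcupP; exists (Ordinal iA) => //; rewrite inE /z /=.
  move: i1 i2; rewrite ler_pdivlMr ?mulr_gt0// ltr_pdivrMr ?mulr_gt0// -natr1.
  rewrite /u ler_norml => ? ?; apply/andP; split; lra.
have : (#|\bigcup_i trap k (derive1 tau) rho n y (z i)|%SET <= \sum_(i < A) #|trap k (derive1 tau) rho n y (z i)|)%N.
  elim/big_rec2: _ => [|i m S _ IH]; first by rewrite cards0.
  by rewrite cardsU; apply: leq_trans (leq_subr _ _) _; rewrite leq_add2l.
move/leq_trans; apply.
apply: (@leq_trans (\sum_(i < A) multiplicity k (derive1 tau) rho n)).
  by apply: leq_sum => i _; exact: trap_le.
by rewrite sum_nat_const card_ord.
Qed.

(** Writing [N] as a multiple of [n] plus a remainder, submultiplicativity gives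
    [trapped_max N <= A * exp (eps * N)] with [A] independent of [N]. *)
Lemma partially_captiveP tau r : (forall i : nat, eps_captive i.+1%:R^-1 tau) ->
  partially_captive k tau r.
Proof.
move=> cap; apply/cvgrPdist_lt => e e0.
pose i := Num.truncn (2 / e).
have ie : i.+1%:R^-1 <= e / 2 :> R.
  rewrite -[e / 2]invrK lef_pV2 ?posrE ?invr_gt0 ?divr_gt0//.
  by rewrite invf_div; exact/ltW/truncnS_gt.
have [n [M [rho [n0 tM Mrho hn]]]] := cap i.
set eps : R := i.+1%:R^-1 in ie hn.
have eps0 : 0 < eps by rewrite invr_gt0.
have M0 : 0 <= M by apply: le_trans (tM 0).
have rho0 : 0 < rho by apply: le_lt_trans Mrho.
pose A := ((Num.truncn (r / rho)).+1 * k ^ n)%N.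
have A0 : (0 < A)%N by rewrite muln_gt0 /= expn_gt0 (ltnW hk).
have bound N : (trapped_max k tau r N)%:R <= A%:R * expR (eps * N%:R).
  apply: (@le_trans _ _ ((Num.truncn (r / rho)).+1 * multiplicity k (derive1 tau) rho N)%N%:R).
    by rewrite ler_nat trapped_max_le.
  rewrite /A !natrM -mulrA ler_wpM2l//.
  have := @multiplicity_pow (derive1 tau) M rho n (N %/ n) (N %% n) tM (ltW Mrho).
  rewrite -divn_eq -(ler_nat R) natrM => h; apply: le_trans h _.
  rewrite mulrC; apply: ler_pM => //.
    by rewrite ler_nat leq_exp2l// ltnW// ltn_pmod.
  rewrite natrX; apply: (@le_trans _ _ ((expR eps ^+ n) ^+ (N %/ n))).
    by rewrite lerXn2r ?nnegrE ?exprn_ge0 ?expR_ge0.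
  rewrite -exprM -expRM_natr ler_expR ler_wpM2l ?(ltW eps0)// ler_nat mulnC.
  exact: leq_trunc_div.
have [N0 hN0] : exists N0 : nat, 2 / e * ln (A%:R) < N0%:R.
  by exists (Num.truncn (2 / e * ln (A%:R))).+1; exact: truncnS_gt.
near=> N.
have NN0 : (N0 < N)%N by near: N; exact: nbhs_infty_gt.
have Npos : 0 < N%:R :> R by rewrite ltr0n; apply: leq_ltn_trans NN0.
have T0 : 0 <= ln (trapped_max k tau r N)%:R :> R.
  have [->|t0] := posnP (trapped_max k tau r N); first by rewrite ln0.
  by rewrite ln_ge0// ler1n.
rewrite sub0r normrN ger0_norm ?mulr_ge0 ?invr_ge0 ?ler0n//.
rewrite mulrC ltr_pdivrMr//.
have : ln (trapped_max k tau r N)%:R <= ln A%:R + eps * N%:R :> R.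
  have [t0|t0] := posnP (trapped_max k tau r N).
    by rewrite t0 ln0// addr_ge0 ?mulr_ge0 ?(ltW eps0) ?ln_ge0 ?ler1n.
  rewrite -[eps * _]expRK -lnM ?posrE ?expR_gt0 ?ltr0n//.
  by rewrite ler_ln ?posrE ?mulr_gt0 ?expR_gt0 ?ltr0n//; exact: bound.
move/le_lt_trans; apply.
have h1 : eps * N%:R <= e / 2 * N%:R by rewrite ler_wpM2r// ltW.
have h2 : ln A%:R < e / 2 * N%:R.
  have lt : 2 / e * ln (A%:R) < N%:R.
    by apply: lt_trans hN0 _; rewrite ltr_nat.
  rewrite -(ltr_pM2l (x := 2 / e)) ?divr_gt0//; apply: lt_le_trans lt _.
  by rewrite mulrA (_ : 2 / e * (e / 2) = 1) ?mul1r//; field; rewrite gt_eqF.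
by have -> : e * N%:R = e / 2 * N%:R + e / 2 * N%:R; [field|lra].
Unshelve. all: by end_near. Qed.

End Captivity.

(** * Density of captivity and the theorem *)

Section Density.
Variables (R : realType) (m : option nat) (k : nat).
Hypotheses (hm : le_order 3 m) (hk : (2 <= k)%N).

(** First [p] is chosen from [gamma], then the gap [D - d] from [p], and [d] last,
    since [gamma ^ d] has to exceed a linear function of [d]. *)
Lemma exists_constants (gamma : R) : 1 < gamma -> exists p d D : nat,
  [/\ (0 < d)%N, (d <= D)%N, 8 * p.+1%:R * k%:R ^+ d <= k%:R ^+ D :> R,
      2 * k%:R ^+ 2 <= (gamma ^+ 2) ^+ p.+1 & (2 * p.+1 ^ 2 * D)%:R <= gamma ^+ d].
Proof.
move=> g1.
have gg : 1 < gamma ^+ 2 by rewrite exprn_egt1.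
have [p hp] := expr_unbounded (2 * k%:R ^+ 2) gg.
have k1 : 1 < k%:R :> R by rewrite ltr1n.
have [s hs] := expr_unbounded (8 * p.+1%:R) k1.
have [d d0 hd] := @expr_dominates R gamma (2 * p.+1 ^ 2)%:R (2 * p.+1 ^ 2 * s)%:R g1 (ler0n _ _) (ler0n _ _).
exists p, d, (d + s)%N; split => //; first exact: leq_addr.
- by rewrite exprD mulrC ler_wpM2l// exprn_ge0.
- by apply: le_trans hp _; rewrite ler_weXn2l// ltW.
- by move: hd; rewrite -natrM -natrD -mulnDr.
Qed.

(** The bumps depend on [eps] only. So they are chosen first, and the bound
    [delta] on the parameters is then adapted to the prescribed neighbourhood of
    [tau]. *)
Lemma eps_captive_dense (eps : R) (tau : Cm_circle R m) (J : nat) (e : R) :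
  0 < eps -> 0 < e ->
  exists2 f : Cm_circle R m, Cm_ball tau J e f & eps_captive k eps f.
Proof.
move=> eps0 e0.
have [M [Lip [M0 Lip0 hM hLip]]] := Cm_derive1_lipschitz tau hm.
pose gamma := expR (eps / 2).
have g1 : 1 < gamma by rewrite expR_gt1 divr_gt0.
have gE : gamma ^+ 2 = expR eps.
  by rewrite expr2 -expRD; congr expR; field.
have [p [d [D [d0 dD gap hp hd]]]] := exists_constants g1.
have [L [Q bumps]] := exists_bumps R d D hk.
set psi := (fun l : 'I_L => _) in bumps.
have [Lpsi Lpsi0 hLpsi] := trig_lipschitz (trig_peak R Q).
have psiL (l : 'I_L) u v : `|psi l u - psi l v| <= Lpsi * `|u - v|.
  apply: le_trans (hLpsi _ _) _; rewrite ler_wpM2l//.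
  by rewrite (_ : u - _ - _ = u - v)//; ring.
have [Phi [c [tPhi PhiE]]] := trig_primitive (trig_peak R Q).
have [C C0 hC] := trig_derivatives_bounded (maxn J 1) tPhi.
pose phi (l : 'I_L) x := Phi (x - l%:R / L%:R).
have tphi l : trig_poly (phi l) by exact: trig_shift.
have phiC j l x : (j <= maxn J 1)%N -> `|derive1n j (phi l) x| <= C.
  by move=> jJ; rewrite /phi derive1n_translate; exact: hC.
pose delta : R := Num.min 1 (e / (L%:R * C + 1)).
have LC0 : 0 <= L%:R * C by rewrite mulr_ge0.
have delta0 : 0 < delta by rewrite lt_min ltr01 divr_gt0// ltr_wpDl.
have [delta1 deltae] : delta <= 1 /\ delta <= e / (L%:R * C + 1).
  by rewrite /delta !ge_min !lexx orbT.
pose rho := M + L%:R * C + 1.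
have rho0 : 0 <= rho by rewrite !addr_ge0.
(* The radius exceeds the sup norm of the derivative of every perturbed function,
   as [delta <= 1]. *)
have [t [t01 [n n0 hn]]] := perturbation hk d0 dD bumps gap g1 hp hd Lpsi0 psiL Lip0 hLip rho0 delta0.
pose g x := \sum_l t l * phi l x.
have tg : trig_poly g by exact: trig_lincomb.
pose f := MkCmCircle (is_Cm_add_trig (Cm_funP tau) tg).
have gC j x : (j <= maxn J 1)%N -> `|derive1n j g x| <= L%:R * (delta * C).
  move=> jJ; rewrite /g derive1n_lincomb//.
  apply: le_trans (ler_norm_sum _ _ _) _.
  apply: (@le_trans _ _ (\sum_(l < L) delta * C)); last first.
    by rewrite sumr_const card_ord -[X in X <= _]mulr_natl.
  apply: ler_sum => l _; have /andP[? ?] := t01 l.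
  by rewrite normrM ger0_norm// ler_pM// phiC.
have fE j x : le_order j m -> derive1n j f x = derive1n j tau x + derive1n j g x.
  by move=> jm; rewrite (derive1n_add_trig (Cm_funP tau) tg jm).
have m1 : le_order 1 m by move: hm; rewrite /le_order; case: (m) => // r; apply: leq_trans.
exists f.
  move=> j jJ jm x; rewrite fE// addrAC subrr add0r.
  apply: le_lt_trans (gC j x _) _; first by rewrite leq_max jJ.
  have LC1 : 0 < L%:R * C + 1 by rewrite ltr_wpDl.
  have : delta * (L%:R * C + 1) <= e by rewrite -ler_pdivlMr.
  by rewrite mulrDr mulr1 mulrCA; lra.
exists n, (M + L%:R * C), rho; split=> //.
- move=> x; have := fE 1%N x m1; rewrite !derive1n1 => ->.
  apply: le_trans (ler_normD _ _) _; apply: lerD (hM x) _.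
  have := gC 1%N x; rewrite derive1n1 leq_max orbT => /(_ isT) h.
  by apply: le_trans h _; rewrite ler_wpM2l// ler_piMl.
- by rewrite ltrDl.
- rewrite gE in hn; apply: (le_trans _ hn).
  have -> : derive1 f = (fun x => perturb psi (derive1 tau) t x + - (c * \sum_l t l)).
    apply/funext => x; have := fE 1%N x m1; rewrite !derive1n1 => ->.
    rewrite /perturb -addrA; congr (_ + _).
    rewrite -[derive1 g]derive1n1 /g derive1n_lincomb// mulr_sumr -sumrB.
    apply: eq_bigr => l _; rewrite derive1n1 /phi derive1_translate PhiE /psi; ring.
  by rewrite ler_nat; exact: multiplicity_addcst.
Qed.

End Density.

Theorem theorem3p6 (R : realType) (m : option nat) (k : nat)
    (kappa : R) (R_kappa : Cm_circle R m -> R)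
    (hm : le_order 3 m) (hk : (2 <= k)%N)
    (hkappa : 1 < kappa < lambda R k)
    (hR_kappa : forall tau : Cm_circle R m,
        C_tau tau / (lambda R k - kappa) <= R_kappa tau) :
  meager (not_captive k R_kappa) /\ interior (not_captive k R_kappa) = set0.
Proof.
have m1 : le_order 1 m by move: hm; rewrite /le_order; case: (m) => // r; apply: leq_trans.
pose good i : set (Cm_circle R m) := [set tau : Cm_circle R m | eps_captive k (i.+1%:R^-1) tau].
have good_open i tau : good i tau -> nbhs tau (good i).
  move=> /(eps_captive_open hk)[delta delta0 hd].
  apply: (@filterS _ (nbhs tau) (nbhs_filter tau) _ _ _ (nbhs_derive1 tau m1 delta0)).
  by move=> f /= hf; exact: hd.
have captive tau : (forall i, good i tau) -> ~ not_captive k R_kappa tau.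
  by move=> h; apply; apply: (partially_captiveP hk).
split.
  exists (fun i => not_captive k R_kappa `&` ~` good i).
    move=> i; rewrite /nowhere_dense -subset0 => tau /nbhs_Cm_ball[J [e [e0 he]]].
    have eps0 : 0 < i.+1%:R^-1 :> R by rewrite invr_gt0.
    have [f fb fg] := eps_captive_dense hm hk tau J eps0 e0.
    by have [h [[_ nh] gh]] := he _ fb _ (good_open i f fg).
  apply/seteqP; split=> [tau nt|tau [i _ []]//].
  apply: contrapT => nex; apply: (captive tau) => // i.
  by apply: contrapT => ng; apply: nex; exists i.
rewrite -subset0 => tau /nbhs_Cm_ball[J0 [e0 [e00 he]]].
(* Baire's argument: balls of rapidly decreasing radii, the [i]-th one contained
   in [good i], whose centres converge to a function lying in all of them. *)
pose S := (Cm_circle R m * nat * R)%type.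
have step (i : nat) (s : S) : exists s' : S, 0 < s.2 ->
   [/\ 0 < s'.2, s'.2 <= s.2 / 2, (s.1.2 < s'.1.2)%N,
       forall j, (j <= s.1.2)%N -> le_order j m ->
         forall x, `|derive1n j s'.1.1 x - derive1n j s.1.1 x| <= s.2 / 4
     & Cm_ball s'.1.1 s'.1.2 s'.2 `<=` good i].
  case: s => -[f J] e /=; have [ee|] := boolP (0 < e); last by exists (f, J, e).
  have e4 : 0 < e / 4 by rewrite divr_gt0.
  have eps0 : 0 < i.+1%:R^-1 :> R by rewrite invr_gt0.
  have [f' fb fg] := eps_captive_dense hm hk f J eps0 e4.
  have [J' [e' [e'0 he']]] := nbhs_Cm_ball (good_open i f' fg).
  exists (f', maxn J.+1 J', Num.min e' (e / 2)) => _ /=; split.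
  - by rewrite lt_min e'0 divr_gt0.
  - by rewrite ge_min lexx orbT.
  - by rewrite leq_max leqnn.
  - by move=> j jJ jm x; apply: ltW; exact: fb.
  - move=> h hh; apply: he' => j jJ jm x; have := hh j _ jm x.
    by rewrite leq_max jJ orbT lt_min => /(_ isT)/andP[].
have [next nextP] := choice (fun w : nat * S => step w.1 w.2).
pose s : nat -> S := fun i => nat_rect (fun=> S) (tau, J0, e0) (fun i si => next (i, si)) i.
have s0 i : 0 < (s i).2.
  by elim: i => [//|i IH]; have [] := nextP (i, s i) IH.
have sP i := nextP (i, s i) (s0 i).
have iJ i : (i <= (s i).1.2)%N.
  elim: i => [//|i IH]; have [_ _ lt _ _] := sP i.
  exact: leq_ltn_trans IH lt.
have [g hg] := @Cm_limit R m (fun i => (s i).1.1) (fun i => (s i).1.2) (fun i => (s i).2)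
  (fun i => ltW (s0 i)) (fun i => let: And5 _ h _ _ _ := sP i in h) iJ
  (fun i => let: And5 _ _ h _ _ := sP i in ltnW h)
  (fun i => let: And5 _ _ _ h _ := sP i in h).
have inball i : Cm_ball (s i).1.1 (s i).1.2 (s i).2 g.
  move=> j jJ jm x; apply: le_lt_trans (hg i j jJ jm x) _.
  by have := s0 i; lra.
apply: (captive g); last exact: (he g (inball 0%N)).
by move=> i; have [_ _ _ _ sub] := sP i; apply: sub; exact: (inball i.+1).
Qed.
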